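(* Let $p\geq 2$, let $q$ be defined by $1/p+1/q=1$, and let $\Phi(x)=\|x\|^p/p$ for $x\in\mathbb{R}^n$, where $\|\cdot\|$ is the Euclidean norm on $\mathbb{R}^n$. Let $\mu_\Phi$ be the probability measure $d\mu_\Phi(x)=\frac{e^{-\Phi(x)}}{Z_\Phi}dx$ with $Z_\Phi=\int e^{-\Phi(x)}dx$. Then there exists a constant $c>0$ such that for every smooth enough function $g$ on $\mathbb{R}^n$, $$\mathbf{Ent}_{\mu_\Phi}(e^g)\leq c\int \|\nabla g\|^q e^g\,d\mu_\Phi .$$
   Context: $dx$ is Lebesgue measure on $\mathbb{R}^n$. For a probability measure $\mu$, $\mathbf{Ent}_{\mu}(e^g)=\int e^g\log\frac{e^g}{\int e^g d\mu}\,d\mu$. ''Smooth enough'' is meant to include that the integrals involved exist. *)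

(* Defs.v *)
From HB Require Import structures.
From mathcomp Require Import all_boot all_order all_algebra.
From mathcomp Require Import all_classical all_reals all_analysis.
From mathcomp Require Import measurable_realfun.

Set Implicit Arguments.
Unset Strict Implicit.
Unset Printing Implicit Defensive.

Import Order.TTheory GRing.Theory Num.Theory.
Import numFieldNormedType.Exports.

Local Open Scope classical_set_scope.
Local Open Scope ring_scope.

(* Row vectors carry the product sigma-algebra, exactly as n.-tuple T does in
   measurable_structure.v; for T = R this is the Borel sigma-algebra of R^n. *)
Definition measure_rV_display : measure_display -> measure_display.
Proof. exact. Qed.

Section measurable_rV.
Context {d} {T : sigmaRingType d}.
Variable n : nat.

Let coors : 'I_n -> 'rV[T]_n -> T := fun i x => x ord0 i.

Let rV_set0 : g_sigma_preimage coors set0.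
Proof. exact: sigma_algebra0. Qed.

Let rV_setC A : g_sigma_preimage coors A -> g_sigma_preimage coors (~` A).
Proof. exact: sigma_algebraC. Qed.

Let rV_bigcup (F : _^nat) : (forall i, g_sigma_preimage coors (F i)) ->
  g_sigma_preimage coors (\bigcup_i (F i)).
Proof. exact: sigma_algebra_bigcup. Qed.

HB.instance Definition _ := @isMeasurable.Build (measure_rV_display d)
  'rV[T]_n (g_sigma_preimage coors) rV_set0 rV_setC rV_bigcup.

End measurable_rV.

Lemma measurable_coord d (T : sigmaRingType d) n (i : 'I_n) :
  measurable_fun [set: 'rV[T]_n] (fun v => v ord0 i).
Proof.
move=> _ Y mY; rewrite setTI; apply: sub_sigma_algebra => /=.
rewrite -bigcup_seq/=; exists i => /=; first by rewrite mem_index_enum.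
by exists Y => //; rewrite setTI.
Qed.

Lemma measurable_fun_rV d1 d2 (T1 : measurableType d1) (T2 : measurableType d2)
    n (f : T1 -> 'rV[T2]_n) :
  (forall i, measurable_fun [set: T1] (fun x => f x ord0 i)) ->
  measurable_fun [set: T1] f.
Proof.
move=> mf.
suff H : g_sigma_preimage (fun i => (fun v : 'rV[T2]_n => v ord0 i) \o f)
    `<=` measurable.
  by move=> _ A mA; apply: H; rewrite g_sigma_preimage_comp; exists A.
apply: smallest_sub; first exact: sigma_algebra_measurable.
case: n => [|n] in f mf *; first by rewrite big_ord0.
rewrite -bigcup_mkord_ord; apply: bigcup_sub => i Ii.
by move=> A [B mB <-]; exact: mf.
Qed.

Section rV_cons.
Context {R : realType}.
Variable n : nat.

Definition rV_cons (xv : measurableTypeR R * 'rV[R]_n) : 'rV[R]_n.+1 :=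
  \row_i (if unlift ord0 i is Some j then xv.2 ord0 j else xv.1).

Definition rV_uncons (v : 'rV[R]_n.+1) : measurableTypeR R * 'rV[R]_n :=
  (v ord0 ord0, \row_j v ord0 (lift ord0 j)).

Lemma rV_consK : cancel rV_cons rV_uncons.
Proof.
case=> x v; rewrite /rV_uncons mxE unlift_none; congr pair.
by apply/rowP => j; rewrite !mxE liftK.
Qed.

Lemma measurable_rV_cons : measurable_fun setT rV_cons.
Proof.
apply: measurable_fun_rV => i.
have [j ->|->] := unliftP ord0 i.
  rewrite (_ : (fun _ => _) =
    (fun v : 'rV[R]_n => v ord0 j) \o (@snd R 'rV[R]_n)).
    by apply: measurableT_comp => //; exact: measurable_coord.
  by apply/funext => x; rewrite mxE liftK.
rewrite (_ : (fun _ => _) = (@fst R 'rV[R]_n)) //.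
by apply/funext => x; rewrite mxE unlift_none.
Qed.

Lemma measurable_rV_uncons : measurable_fun setT rV_uncons.
Proof.
apply: measurable_fun_pair; first exact: measurable_coord.
apply: measurable_fun_rV => j.
under eq_fun do rewrite mxE; exact: measurable_coord.
Qed.

End rV_cons.

Section lebesgue_rVS.
Local Open Scope ereal_scope.
Context (R : realType) (n : nat).
Variable m : {sigma_finite_measure set 'rV[R]_n -> \bar R}.

Definition lebesgue_rVS : set 'rV[R]_n.+1 -> \bar R :=
  pushforward (lebesgue_measure \x m) (@rV_cons R n).

Let measurable_rV_cons_preimage A :
  measurable A -> measurable (@rV_cons R n @^-1` A).
Proof.
by move=> mA; rewrite -[X in measurable X]setTI; exact: measurable_rV_cons.
Qed.

Let lebesgue_rVS0 : lebesgue_rVS set0 = 0.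
Proof. by rewrite /lebesgue_rVS /pushforward preimage_set0 measure0. Qed.

Let lebesgue_rVS_ge0 A : 0 <= lebesgue_rVS A.
Proof. by rewrite /lebesgue_rVS /pushforward measure_ge0. Qed.

Let lebesgue_rVS_sigma_additive : semi_sigma_additive lebesgue_rVS.
Proof.
move=> F mF tF mUF; rewrite /lebesgue_rVS /pushforward preimage_bigcup.
apply: measure_semi_sigma_additive.
- by move=> k; exact: measurable_rV_cons_preimage.
- apply/trivIsetP => /= i j _ _ ij; rewrite -preimage_setI.
  by move/trivIsetP : tF => /(_ _ _ _ _ ij) ->//; rewrite preimage_set0.
- by rewrite -preimage_bigcup; exact: measurable_rV_cons_preimage.
Qed.

HB.instance Definition _ := isMeasure.Build _ _ _ lebesgue_rVS
  lebesgue_rVS0 lebesgue_rVS_ge0 lebesgue_rVS_sigma_additive.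

Let lebesgue_rVS_sigma_finite : sigma_finite setT lebesgue_rVS.
Proof.
have /sigma_finiteP[F [TF ndF Foo]] := sigma_finiteT (@lebesgue_measure R).
have /sigma_finiteP[G [TG ndG Goo]] := sigma_finiteT m.
exists (fun k => @rV_uncons R n @^-1` (F k `*` G k)).
  apply/esym; rewrite -preimage_bigcup -subTset => v _.
  have [i _ Fi] : (\bigcup_i F i) (rV_uncons v).1 by rewrite -TF.
  have [j _ Gj] : (\bigcup_i G i) (rV_uncons v).2 by rewrite -TG.
  exists (maxn i j) => //; split.
    by move: Fi; exact/subsetPset/ndF/leq_maxl.
  by move: Gj; exact/subsetPset/ndG/leq_maxr.
move=> k; have [mF Fk] := Foo k; have [mG Gk] := Goo k.
have mFG : measurable (F k `*` G k) by exact: measurableX.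
split; first by rewrite -[X in measurable X]setTI; exact: measurable_rV_uncons.
rewrite /lebesgue_rVS /pushforward -comp_preimage.
rewrite (_ : _ \o _ = id); last by apply/funext => x /=; rewrite rV_consK.
by rewrite preimage_id product_measure1E// lte_mul_pinfty// ge0_fin_numE.
Qed.

HB.instance Definition _ :=
  Measure_isSigmaFinite.Build _ _ _ lebesgue_rVS lebesgue_rVS_sigma_finite.

End lebesgue_rVS.

(* R^0 is a point, of mass 1; R^(n+1) is R x R^n. *)
Fixpoint lebesgue_rV (R : realType) (n : nat) :
    {sigma_finite_measure set 'rV[R]_n -> \bar R} :=
  match n with
  | 0 => dirac (0 : 'rV[R]_0)
  | n'.+1 => lebesgue_rVS (lebesgue_rV R n')
  end.

Lemma lebesgue_rV_prod (R : realType) n (A : 'I_n -> set R) :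
  (forall i, measurable (A i)) ->
  lebesgue_rV R n [set v | forall i, A i (v ord0 i)] =
  (\prod_(i < n) lebesgue_measure (A i))%E.
Proof.
elim: n A => [|n IHn] A mA.
  rewrite big_ord0 /= diracE mem_set//; by case.
rewrite big_ord_recl /= /lebesgue_rVS /pushforward.
set B := [set v : 'rV[R]_n | forall i, A (lift ord0 i) (v ord0 i)].
have mB : measurable B.
  rewrite (_ : B = \bigcap_(i in [set: 'I_n])
    [set v : 'rV[R]_n | A (lift ord0 i) (v ord0 i)]).
    apply: fin_bigcap_measurable; first exact: finite_finset.
    move=> i _; rewrite -[X in measurable X]setTI.
    exact: (@measurable_coord _ R n i).
  by apply/seteqP; split => v /= h i => [_|]; exact: h.
have /= <- := IHn (fun i => A (lift ord0 i)) (fun i => mA _).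
rewrite -[RHS](@product_measure1E _ _ _ _ _ lebesgue_measure) //; last exact: mA.
congr (product_measure1 _ _ _); apply/seteqP; split => -[x v] /=.
  move=> Av; split; first by have := Av ord0; rewrite mxE unlift_none.
  by move=> i; have := Av (lift ord0 i); rewrite mxE liftK.
move=> [Ax Av] i; rewrite mxE.
by have [j ->|->] := unliftP ord0 i; [exact: Av|].
Qed.

Definition enorm (R : realType) n (x : 'rV[R]_n) : R :=
  Num.sqrt (\sum_(i < n) x ord0 i ^+ 2).

Definition gradient (R : realType) n (g : 'rV[R]_n -> R) (x : 'rV[R]_n) :
    'rV[R]_n :=
  \row_(i < n) 'D_(delta_mx ord0 i) g x.

(* Differentiability and continuity refer to the sup norm, the topology of
   'rV[R]_n; on R^n this agrees with the Euclidean norm. *)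
Definition C1 (R : realType) n (g : 'rV[R]_n -> R) : Prop :=
  (forall x, differentiable g x) /\ continuous (gradient g).

Section gibbs_measure.
Context (R : realType) (n : nat).
Variable Phi : {mfun 'rV[R]_n >-> R}.

Definition partition_function : R := \int[lebesgue_rV R n]_x expR (- Phi x).

Definition gibbs_measure (A : set 'rV[R]_n) : \bar R :=
  (\int[lebesgue_rV R n]_(x in A) (expR (- Phi x) / partition_function)%:E)%E.

Let gibbs_density_ge0 x :
  (0 <= (expR (- Phi x) / partition_function)%:E :> \bar R)%E.
Proof.
by rewrite lee_fin divr_ge0 ?expR_ge0// Rintegral_ge0// => y _;
  exact: expR_ge0.
Qed.

Let gibbs_measure0 : gibbs_measure set0 = 0%E.
Proof. exact: integral_set0. Qed.

Let gibbs_measure_ge0 A : (0 <= gibbs_measure A)%E.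
Proof. by apply: integral_ge0 => x _; exact: gibbs_density_ge0. Qed.

Let gibbs_measure_sigma_additive : semi_sigma_additive gibbs_measure.
Proof.
apply: semi_sigma_additive_nng_induced => //.
apply/measurable_EFinP; apply: measurable_funM => //.
by apply: measurableT_comp => //; exact: measurableT_comp.
Qed.

HB.instance Definition _ := isMeasure.Build _ _ _ gibbs_measure
  gibbs_measure0 gibbs_measure_ge0 gibbs_measure_sigma_additive.

End gibbs_measure.

Section power_potential.
Context (R : realType) (n : nat) (p : R).

Definition power_potential (x : 'rV[R]_n) : R := enorm x `^ p / p.

Let measurable_power_potential : measurable_fun setT power_potential.
Proof.
apply: measurable_funM => //.
apply: (measurableT_comp (measurable_powR _)).
rewrite /enorm.
apply: (measurableT_comp (f := @Num.sqrt R)).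
  apply: continuous_measurable_fun; exact: sqrt_continuous.
apply: measurable_sum => i; apply: measurable_funX; exact: measurable_coord.
Qed.

HB.instance Definition _ :=
  isMeasurableFun.Build _ _ _ _ power_potential measurable_power_potential.

End power_potential.

Section entropy.
Context d (T : measurableType d) (R : realType).
Variable mu : {measure set T -> \bar R}.

Definition entropy_integrand (f : T -> R) (x : T) : R :=
  f x * ln (f x / \int[mu]_y f y).

Definition entropy (f : T -> R) : R := \int[mu]_x entropy_integrand f x.

End entropy.

(* Main.v *)
Require Import Defs.
From HB Require Import structures.
From mathcomp Require Import all_boot all_order all_algebra.
From mathcomp Require Import all_classical all_reals all_analysis.
From mathcomp Require Import measurable_realfun.
From mathcomp Require Import ring lra.

(** The proof follows the route from the inequality of Prekopa and Leindler to
    logarithmic Sobolev inequalities.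

    The inequality of Prekopa and Leindler bounds from below the integral of a
    function [h] such that [h (t x + s y) >= u x ^ t * v y ^ s], with
    [t + s = 1], by the product of the powers [t] and [s] of the integrals of
    [u] and [v]. It holds on the line because the measure of [t A + s B] is at
    least [t |A| + s |B|], and in R^n by induction on the dimension.

    Apply it to [u = exp (g / t - Phi)] and [v = exp (- Phi)], and let [s]
    tend to 0. The power [t] of the integral of [exp (g / t)] is
    [I + s Ent (exp g) + o (s)], where [I] is the integral of [exp g]: the
    entropy is a derivative in [s]. On the other side, [h z] is the largest
    value of [exp (g x - t Phi x - s Phi y)] over the decompositions
    [z = t x + s y]. Since [p >= 2], the potential is uniformly convex, in the
    sense that [t Phi x + s Phi y - Phi z >= s (|x - y| / 4)^p / p] for
    [t >= 1/2] ([power_potential_uniformly_convex]). As [x = z + s (x - y)],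
    the exponent of [h z] exceeds [g z - Phi z] by at most [s] times the
    supremum over [w] of [<grad g z, w> - (|w| / 4)^p / p], up to [o (s)]. By
    Young's inequality this supremum is at most [(4 |grad g z|)^q / q]
    ([growth_bound]). Comparing the terms of order [s]
    ([entropy_le_perturbed]) proves the inequality.

    These expansions are uniform when [g] is bounded with a bounded and
    uniformly continuous gradient ([log_sobolev_bounded]). A general [g] is
    reached through the logarithms of [e + psi exp g], where [psi] is a
    compactly supported cutoff. Their gradient terms are controlled by those
    of [g] because [1 < q <= 2] ([gradient_ln_truncation_le]), and their
    entropies converge by domination ([log_sobolev]). *)

Set Implicit Arguments.
Unset Strict Implicit.
Unset Printing Implicit Defensive.

Import Order.TTheory GRing.Theory Num.Theory.
Import numFieldNormedType.Exports.

Local Open Scope classical_set_scope.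
Local Open Scope ring_scope.

(** * The inequality of Brunn and Minkowski on the line *)

Section one_dimensional_brunn_minkowski.
Context {R : realType}.
Local Notation leb := (@lebesgue_measure R).
Implicit Types (A B C : set R) (r b : R).

Let measurable_affine r b :
  measurable_fun [set: measurableTypeR R] (fun x => r * x + b : measurableTypeR R).
Proof. by apply: measurable_funD => //; exact: measurable_funM. Qed.

Lemma lebesgue_measure_affine_preimage r b A : 0 < r -> measurable A ->
  (r%:E * leb ((fun x => (r * x + b)%R) @^-1` A) = leb A)%E.
Proof.
move=> r0 mA.
pose m : {measure set (measurableTypeR R) -> \bar R} :=
  mscale (NngNum (ltW r0)) (pushforward leb (fun x => r * x + b : measurableTypeR R)).
have -> : leb A = m (measurable_affine r b) A; last by [].
apply: lebesgue_measure_unique => //= _ [[x y]] _ <-.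
rewrite -[RHS]/(r%:E * leb ((fun x => (r * x + b)%R) @^-1` `]x, y]%classic))%E.
have -> : (fun z => r * z + b) @^-1` `]x, y]%classic =
    `](x - b) / r, (y - b) / r]%classic.
  apply/seteqP; split => z /=; rewrite !in_itv /= => /andP[h1 h2].
    by rewrite ltr_pdivrMr// ler_pdivlMr// mulrC ltrBlDr lerBrDr h1.
  by move: h1 h2; rewrite ltr_pdivrMr// ler_pdivlMr// mulrC ltrBlDr lerBrDr => -> ->.
rewrite !lebesgue_measure_itv /= !lte_fin ltr_pM2r ?invr_gt0// ltrD2r.
case: ifP => _; last by rewrite mule0.
by rewrite -!EFinD -EFinM; congr (_%:E); field; rewrite gt_eqF.
Qed.

Lemma lebesgue_measure_affine_image r b A : 0 < r -> measurable A ->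
  measurable ((fun x => r * x + b) @` A) /\
  (leb [set (r * x + b)%R | x in A] = r%:E * leb A)%E.
Proof.
move=> r0 mA.
have -> : (fun x => r * x + b) @` A = (fun x => r^-1 * x - b / r) @^-1` A.
  apply/seteqP; split => [_ [x Ax <-]|x Ax] /=.
    suff -> : r^-1 * (r * x + b) - b / r = x by [].
    by field; rewrite gt_eqF.
  by exists (r^-1 * x - b / r) => //; field; rewrite gt_eqF.
split; first by rewrite -[X in measurable X]setTI; exact: measurable_affine.
rewrite -[in RHS](@lebesgue_measure_affine_preimage r^-1 (- (b / r)))// ?invr_gt0//.
by rewrite muleA -EFinM divff ?gt_eqF// mul1e.
Qed.

(** Let [a] be the largest point of [A] and [b] the least point of [B]. The
    translates [t A + s b] and [t a + s B] lie in [C], and the first one ends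
    at [t a + s b], where the second one starts: they only share this point,
    so their measures add up. *)
Let brunn_minkowski_compact s t A B C : 0 < t -> 0 < s ->
  compact A -> compact B -> A !=set0 -> B !=set0 -> measurable C ->
  (forall x y, A x -> B y -> C (t * x + s * y)) ->
  (t%:E * leb A + s%:E * leb B <= leb C)%E.
Proof.
move=> t0 s0 cA cB A0 B0 mC ABC.
have [a Aa amax] : exists2 a, A a & forall x, A x -> x <= a.
  have := @compact_EVT_max R R id A => /(_ A0 cA)[|a].
    by apply: continuous_subspaceT => ?; exact: cvg_id.
  by rewrite inE => Aa h; exists a => // x Ax; apply: h; rewrite inE.
have [b Bb bmin] : exists2 b, B b & forall x, B x -> b <= x.
  have := @compact_EVT_min R R id B => /(_ B0 cB)[|b].
    by apply: continuous_subspaceT => ?; exact: cvg_id.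
  by rewrite inE => Bb h; exists b => // x Bx; apply: h; rewrite inE.
have [mA' eA'] := lebesgue_measure_affine_image (s * b) t0 (compact_measurable cA).
have [mB' eB'] := lebesgue_measure_affine_image (t * a) s0 (compact_measurable cB).
set A' := _ @` A in mA' eA'; set B' := _ @` B in mB' eB'.
rewrite -eA' -eB'.
have mA'1 : measurable (A' `\ (t * a + s * b)) by exact: measurableD.
have -> : leb A' = leb (A' `\ (t * a + s * b)).
  rewrite -{1}(@setD1K _ (t * a + s * b) A'); last by exists a.
  rewrite measureU// ?setDIK// -[RHS]add0e; congr (_ + _)%E.
  exact: lebesgue_measure_set1.
rewrite -measureU//; last first.
  rewrite -subset0 => _ [[[x Ax <-] /= ne] [y By] e]; apply: ne.
  have := amax x Ax; rewrite -(ler_pM2l t0) => h1.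
  have := bmin y By; rewrite -(ler_pM2l s0) => h2; lra.
apply: le_measure; rewrite ?inE//.
  exact: measurableU.
move=> z [[[x Ax <-] _]|[y By <-]]; first exact: ABC.
by rewrite addrC; exact: ABC.
Qed.

(** By inner regularity it is enough to treat compact subsets of [A] and [B].
    One point of [A], and one of [B], is added to these to keep them
    nonempty. *)
Lemma brunn_minkowski_line s t A B C : 0 < t -> 0 < s ->
  measurable A -> measurable B -> measurable C -> A !=set0 -> B !=set0 ->
  (forall x y, A x -> B y -> C (t * x + s * y)) ->
  (t%:E * leb A + s%:E * leb B <= leb C)%E.
Proof.
move=> t0 s0 mA mB mC [a Aa] [b Bb] ABC.
have compactU1 (K : set R) x : compact K -> compact (K `|` [set x]).
  by move=> cK; apply: compactU => //; exact: compact_set1.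
have approx r (D : set R) (x0 : R) (l : \bar R) : 0 < r -> measurable D -> D x0 ->
    (0 <= l)%E ->
    (forall K, compact K -> K `<=` D -> K !=set0 -> r%:E * leb K + l <= leb C)%E ->
    (r%:E * leb D + l <= leb C)%E.
  move=> r0 mD Dx0 l0 H.
  have [->|Coo] := eqVneq (leb C) +oo%E; first by rewrite leey.
  have lfin : l \is a fin_num.
    have : (r%:E * leb [set x0] + l <= leb C)%E.
      by apply: H; [exact: compact_set1|move=> _ ->|exists x0].
    rewrite lebesgue_measure_set1 mule0 add0e => lC.
    by rewrite ge0_fin_numE//; apply: le_lt_trans lC _; rewrite ltey.
  rewrite -leeBrDr// muleC -lee_pdivlMr// lebesgue_regularity_inner_sup//.
  apply: ge_ereal_sup => _ [K [cK KD] <-].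
  rewrite lee_pdivlMr// muleC leeBrDr//.
  apply: le_trans (H (K `|` [set x0]) _ _ _).
  - rewrite leeD2r// lee_pmul2l//; apply: le_measure; rewrite ?inE//.
    + exact: (compact_measurable cK).
    + exact: (compact_measurable (compactU1 _ x0 cK)).
  - exact: compactU1.
  - by move=> z [/KD//|->].
  - by exists x0; right.
apply: (approx t _ a) => //; first by rewrite mule_ge0// lee_fin ltW.
move=> K cK KA K0; rewrite addeC.
apply: (approx s _ b) => //; first by rewrite mule_ge0// lee_fin ltW.
move=> L cL LB L0; rewrite addeC.
by apply: brunn_minkowski_compact => // x y /KA Ax /LB By; exact: ABC.
Qed.

End one_dimensional_brunn_minkowski.

(** * The inequality of Prekopa and Leindler on the line *)

(** [c] dominates the weighted geometric mean of [a] and [b], all three in the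
    extended half-line. Quantifying over the reals below [a] and [b] avoids the
    products of 0 and infinity, and gives a relation between functions that
    passes to their integrals in the same form. *)
Definition gmean_le (R : realType) (t s : R) (a b c : \bar R) : Prop :=
  forall a' b' : R, 0 < a' -> 0 < b' -> (a'%:E < a)%E -> (b'%:E < b)%E ->
    ((a' `^ t * b' `^ s)%:E <= c)%E.

Section prekopa_leindler_line.
Context {R : realType}.
Local Notation leb := (@lebesgue_measure R).
Local Open Scope ereal_scope.
Implicit Types (f h : R -> \bar R) (s t : R).

Lemma measurable_superlevel f (r : R) : measurable_fun [set: measurableTypeR R] f ->
  measurable [set x | r%:E < f x].
Proof.
move=> mf; rewrite -[X in measurable X]setTI; apply: measurable_lte => //.
Qed.

Let measurable_hypograph f : measurable_fun [set: measurableTypeR R] f ->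
  measurable [set z : measurableTypeR R * measurableTypeR R | z.2%:E < f z.1].
Proof.
move=> mf; rewrite -[X in measurable X]setTI; apply: measurable_lte => //.
  by apply/measurable_EFinP; exact: measurable_snd.
by apply: (measurableT_comp mf); exact: measurable_fst.
Qed.

Let measurable_superlevel_measure f : measurable_fun [set: measurableTypeR R] f ->
  measurable_fun [set: measurableTypeR R] (fun r => leb [set x | r%:E < f x]).
Proof.
move=> /measurable_hypograph/(measurable_fun_ysection leb); congr (measurable_fun _ _).
apply/funext => r /=; congr (leb _).
by apply/seteqP; split => x; rewrite /ysection /= inE.
Qed.

(** Both sides measure the part of the hypograph of [f] that lies between the
    heights 0 and 1: the first integral adds up its vertical sections, the
    second one its horizontal sections. *)
Lemma truncated_layer_cake f : measurable_fun [set: measurableTypeR R] f ->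
  (forall x, 0 <= f x) ->
  \int[leb]_x mine (f x) 1 = \int[leb]_(r in `]0%R, 1%R[) leb [set x | r%:E < f x].
Proof.
move=> mf f0.
pose E := [set z : measurableTypeR R * measurableTypeR R | (0 < z.2)%R && (z.2 < 1)%R]
  `&` [set z | z.2%:E < f z.1].
have mE : measurable E.
  apply: measurableI.
    rewrite (_ : [set _ | _] = setT `*` `]0%R, 1%R[%classic).
      exact: measurableX.
    by apply/seteqP; split => -[x r] /=; rewrite in_itv/= => // -[].
  exact: measurable_hypograph.
have xE x : leb (xsection E x) = mine (f x) 1.
  have -> : xsection E x = [set` `]0%R, fine (mine (f x) 1)[].
    apply/seteqP; split => r; rewrite /xsection /= inE /E /= in_itv /=.
      move=> [/andP[-> r1]]; move: (f0 x); case: (f x) => [y||]//=.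
      by rewrite lte_fin -EFin_min /= lt_min r1 andbT.
    move: (f0 x); case: (f x) => [y||]//=.
    + by rewrite -EFin_min /= lt_min => _ /andP[-> /andP[]]; rewrite lte_fin.
    + by move=> _ ->; rewrite ltey.
  rewrite lebesgue_measure_itv/= lte_fin; move: (f0 x); case: (f x) => [y||]//=.
  - rewrite -EFin_min /= lee_fin oppr0 adde0 => y0.
    case: ifPn => //; rewrite -leNgt => m0; congr (_%:E); apply/eqP.
    by rewrite eq_le m0 le_min y0 ler01.
  - by rewrite ltr01 oppr0 adde0.
have yE r : leb (ysection E r) = ((fun r => leb [set x | r%:E < f x]) \_ `]0%R, 1%R[) r.
  rewrite patchE; case: ifPn => [|]; rewrite ?notin_setE ?inE /= in_itv /= => h.
    congr (leb _); apply/seteqP; split => x; rewrite /ysection /E /= inE /=.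
      by case.
    by [].
  rewrite (_ : ysection E r = set0) ?measure0//.
  by apply/seteqP; split => x //; rewrite /ysection /E /= inE /= => -[].
have := indic_fubini_tonelli leb leb mE.
rewrite indic_fubini_tonelli_FE// indic_fubini_tonelli_GE//= => H.
rewrite [RHS]integral_mkcond.
transitivity (\int[leb]_x leb (xsection E x)).
  by apply: eq_integral => x _; rewrite xE.
by rewrite H; apply: eq_integral => r _; rewrite -yE.
Qed.

(** When [u] and [v] both have supremum 1, their superlevel sets of level
    [r < 1] are nonempty, and the superlevel set of [h] contains their
    combination. Integrating the inequality of Brunn and Minkowski over [r]
    gives an arithmetic mean, which is better than the geometric mean. *)
Lemma prekopa_leindler_normalised s t (u v : R -> R) h : (0 < t)%R -> (0 < s)%R ->
  measurable_fun [set: measurableTypeR R] u ->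
  measurable_fun [set: measurableTypeR R] v ->
  measurable_fun [set: measurableTypeR R] h ->
  (forall x, 0 <= u x <= 1)%R -> (forall x, 0 <= v x <= 1)%R -> (forall x, 0 <= h x) ->
  (forall r, r < 1 -> exists x, r < u x)%R ->
  (forall r, r < 1 -> exists x, r < v x)%R ->
  (forall r x y, (0 < r)%R -> (r < u x)%R -> (r < v y)%R ->
     r%:E < h (t * x + s * y)%R) ->
  t%:E * \int[leb]_x (u x)%:E + s%:E * \int[leb]_x (v x)%:E <= \int[leb]_x h x.
Proof.
move=> t0 s0 mu mv mh u01 v01 h0 u1 v1 uvh.
have layer (w : R -> R) : measurable_fun [set: measurableTypeR R] w ->
    (forall x, 0 <= w x <= 1)%R -> \int[leb]_x (w x)%:E =
    \int[leb]_(r in `]0%R, 1%R[) leb [set x | r%:E < (w x)%:E].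
  move=> mw w01; rewrite -truncated_layer_cake//.
  - apply: eq_integral => x _; rewrite -EFin_min min_l//.
    by have /andP[] := w01 x.
  - exact/measurable_EFinP.
  - by move=> x; rewrite lee_fin; have /andP[] := w01 x.
have mlevel (f : R -> \bar R) : measurable_fun [set: measurableTypeR R] f ->
    measurable_fun (`]0%R, 1%R[%classic : set (measurableTypeR R))
      (fun r => leb [set x | r%:E < f x]).
  by move=> mf; apply/measurable_funTS; exact: measurable_superlevel_measure.
apply: (@le_trans _ _ (\int[leb]_x mine (h x) 1)); last first.
  apply: ge0_le_integral => //.
  - by move=> x _; rewrite le_min h0 lee01.
  - exact: measurable_mine.
  - by move=> x _; rewrite ge_min lexx.
rewrite truncated_layer_cake// !layer//.
rewrite -!ge0_integralZl//; last 4 first.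
- by apply: mlevel; exact/measurable_EFinP.
- by rewrite lee_fin ltW.
- by apply: mlevel; exact/measurable_EFinP.
- by rewrite lee_fin ltW.
rewrite -ge0_integralD//; last 4 first.
- by move=> r _; rewrite mule_ge0// lee_fin ltW.
- by apply: measurable_funeM; apply: mlevel; exact/measurable_EFinP.
- by move=> r _; rewrite mule_ge0// lee_fin ltW.
- by apply: measurable_funeM; apply: mlevel; exact/measurable_EFinP.
apply: ge0_le_integral => //.
- by move=> r _; rewrite adde_ge0// mule_ge0// lee_fin ltW.
- by apply: emeasurable_funD; apply: measurable_funeM; apply: mlevel; exact/measurable_EFinP.
- exact: mlevel.
- move=> r; rewrite /= in_itv/= => /andP[r0 r1].
  apply: brunn_minkowski_line => //.
  + by apply: measurable_superlevel; exact/measurable_EFinP.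
  + by apply: measurable_superlevel; exact/measurable_EFinP.
  + exact: measurable_superlevel.
  + have [x ux] := u1 r r1; by exists x; rewrite /= lte_fin.
  + have [x ux] := v1 r r1; by exists x; rewrite /= lte_fin.
  + by move=> x y /=; rewrite !lte_fin; exact: uvh.
Qed.

Import HBNNSimple.

(** [w] is a simple function below [f] with integral greater than [a], divided
    by its supremum [N]. Simple functions are bounded, so [N] is finite even
    when [f] is unbounded. *)
Let normalised_below (f : R -> \bar R) (a : R) : (forall x, 0 <= f x) ->
  (0 < a)%R -> a%:E < \int[leb]_x f x ->
  exists N : R, exists w : R -> R, [/\ (0 < N)%R,
    measurable_fun [set: measurableTypeR R] w /\ (forall x, 0 <= w x <= 1)%R,
    (forall r, r < 1 -> exists x, r < w x)%R,
    (forall r x, (r < w x)%R -> (r * N)%:E < f x) &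
    (a / N)%:E <= \int[leb]_x (w x)%:E].
Proof.
move=> f0 a0; rewrite ge0_integralTE// => /ereal_sup_gt[_ [phi /= phif <-] aphi].
have phi0 x : (0 <= phi x)%R by exact: fun_ge0.
pose S : set R := range phi.
have [y phiy] : exists y, (0 < phi y)%R.
  apply: contrapT => /forallNP phi_le0; move: aphi.
  rewrite -integralT_nnsfun integral0_eq ?lte_fin ?ltNge ?(ltW a0)// => x _.
  congr (_%:E); apply/eqP; rewrite eq_le phi0 andbT leNgt.
  exact/negP/phi_le0.
have supS : has_sup S.
  split; first by exists (phi y), y.
  have [M [_ HM]] := simple_bounded phi.
  exists (M + 1)%R => _ [x _ <-].
  by apply: le_trans (ler_norm _) _; apply: HM => //; rewrite ltrDl.
have phi_sup x : (phi x <= sup S)%R by apply: sup_upper_bound => //; exists x.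
have N0 : (0 < sup S)%R by exact: lt_le_trans (phi_sup y).
exists (sup S), (fun x => phi x / sup S)%R; split => //.
- split; first exact: measurable_funM.
  by move=> x; rewrite divr_ge0 ?(ltW N0)//= ler_pdivrMr// mul1r.
- move=> r r1; have [||_ [x _ <-] h] := @sup_adherent _ S (sup S - r * sup S).
  + by rewrite subr_gt0 gtr_pMl.
  + by [].
  + by exists x; rewrite ltr_pdivlMr//; move: h; rewrite opprB addrC subrK.
- move=> r x; rewrite ltr_pdivlMr// => h.
  by apply: lt_le_trans (phif x); rewrite lte_fin.
- under eq_integral do rewrite mulrC EFinM.
  rewrite ge0_integralZl//; last 3 first.
  + exact/measurable_EFinP.
  + by move=> x _; rewrite lee_fin.
  + by rewrite lee_fin invr_ge0 ltW.
  rewrite integralT_nnsfun (mulrC a) EFinM lee_pmul2l// ?ltW//.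
  by rewrite lte_fin invr_gt0.
Qed.

(** Young's inequality for the conjugate exponents [t^-1] and [s^-1]. *)
Lemma weighted_amgm s t (a b : R) : (0 < t)%R -> (0 < s)%R -> (t + s = 1)%R ->
  (0 <= a)%R -> (0 <= b)%R -> (a `^ t * b `^ s <= t * a + s * b)%R.
Proof.
move=> t0 s0 ts a0 b0.
have := @conjugate_powR R (a `^ t)%R (b `^ s)%R t^-1%R s^-1%R.
rewrite -!powRrM !mulfV ?gt_eqF// !powRr1// !invrK (mulrC a) (mulrC b).
by apply; rewrite ?powR_ge0// invr_gt0.
Qed.

Let powR_div (x y r : R) : (0 < x)%R -> (0 < y)%R ->
  ((x / y) `^ r = x `^ r / y `^ r)%R.
Proof.
move=> x0 y0; rewrite powRM ?invr_ge0 ?ltW// -powR_inv1 ?ltW//.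
by rewrite -powRrM mulN1r powRN.
Qed.

(** Rescaling [u] and [v] to supremum 1 multiplies the bound that [h] must
    satisfy by a geometric mean of the two factors, so the normalised case
    followed by the inequality between arithmetic and geometric means
    suffices. *)
Lemma prekopa_leindler_line s t (u v h : R -> \bar R) :
  (0 < t)%R -> (0 < s)%R -> (t + s = 1)%R ->
  measurable_fun [set: measurableTypeR R] h ->
  (forall x, 0 <= u x) -> (forall x, 0 <= v x) -> (forall x, 0 <= h x) ->
  (forall x y, gmean_le t s (u x) (v y) (h (t * x + s * y)%R)) ->
  gmean_le t s (\int[leb]_x u x) (\int[leb]_x v x) (\int[leb]_x h x).
Proof.
move=> t0 s0 ts mh u0 v0 h0 uvh a b a0 b0 au bv.
have [N [w [N0 [mw w01] w1 wu aw]]] := normalised_below u0 a0 au.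
have [M [z [M0 [mz z01] z1 zv bz]]] := normalised_below v0 b0 bv.
pose C := (N `^ t * M `^ s)%R.
have C0 : (0 < C)%R by rewrite mulr_gt0// powR_gt0.
have key : t%:E * \int[leb]_x (w x)%:E + s%:E * \int[leb]_x (z x)%:E
    <= \int[leb]_x (C^-1%:E * h x).
  apply: prekopa_leindler_normalised => //.
  - exact: measurable_funeM.
  - by move=> x; rewrite mule_ge0// lee_fin invr_ge0 ltW.
  - move=> r x y r0 rw rz.
    pose r' := ((r + Num.min (w x) (z y)) / 2)%R.
    have rm : (r < Num.min (w x) (z y))%R by rewrite lt_min rw.
    have rr' : (r < r')%R by rewrite /r'; lra.
    have : (r' < Num.min (w x) (z y))%R by rewrite /r'; lra.
    rewrite lt_min => /andP[r'w r'z].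
    have r'0 : (0 < r')%R by exact: lt_trans rr'.
    have := uvh x y (r' * N)%R (r' * M)%R (mulr_gt0 r'0 N0) (mulr_gt0 r'0 M0)
      (wu _ _ r'w) (zv _ _ r'z).
    have -> : ((r' * N) `^ t * (r' * M) `^ s = C * r')%R.
      rewrite (powRM t (ltW r'0) (ltW N0)) (powRM s (ltW r'0) (ltW M0)) mulrACA.
      by rewrite -powRD ?ts ?oner_eq0// powRr1 ?ltW// mulrC.
    move=> H; apply: (@lt_le_trans _ _ r'%:E); first by rewrite lte_fin.
    by rewrite lee_pdivlMl.
rewrite ge0_integralZl// in key; last by rewrite lee_fin invr_ge0 ltW.
rewrite lee_pdivlMl// in key; apply: le_trans key.
rewrite -[(_ * _)%R](divfK (lt0r_neq0 C0)) mulrC EFinM lee_pmul2l//.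
apply: le_trans (leeD (lee_wpmul2l _ aw) (lee_wpmul2l _ bz)).
- rewrite -!EFinM -EFinD lee_fin.
  apply: le_trans (weighted_amgm t0 s0 ts _ _);
    rewrite ?divr_ge0 ?(ltW a0) ?(ltW N0) ?(ltW b0) ?(ltW M0)//.
  rewrite -[leRHS](_ : (a `^ t * b `^ s / C = _)%R)// /C invfM mulrACA.
  by rewrite !powR_div.
- by rewrite lee_fin ltW.
- by rewrite lee_fin ltW.
Qed.

End prekopa_leindler_line.

(** * The inequality of Prekopa and Leindler in R^n *)

Section prekopa_leindler.
Context {R : realType}.
Local Open Scope ereal_scope.

Lemma integral_lebesgue_rVS n (f : 'rV[R]_n.+1 -> \bar R) :
  measurable_fun setT f -> (forall x, 0 <= f x) ->
  \int[lebesgue_rV R n.+1]_x f x =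
  \int[lebesgue_measure]_x \int[lebesgue_rV R n]_v f (rV_cons (x, v)).
Proof.
move=> mf f0; rewrite /=.
rewrite (@ge0_integral_pushforward _ _ _ _ _ _ (@measurable_rV_cons R n)
  (lebesgue_measure \x lebesgue_rV R n))//.
rewrite preimage_setT (fubini_tonelli1 (f \o @rV_cons R n))//.
  exact: (measurableT_comp mf (@measurable_rV_cons R n)).
by move=> x; exact: f0.
Qed.

Lemma rV_cons_comb n (t s x y : R) (v w : 'rV[R]_n) :
  rV_cons (t * x + s * y, t *: v + s *: w)%R =
  (t *: rV_cons (x, v) + s *: rV_cons (y, w))%R.
Proof. by apply/rowP => i; rewrite !mxE; case: unliftP => [j|] _; rewrite ?mxE. Qed.

(** The induction on the dimension rests on Tonelli's theorem: for fixed first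
    coordinates the inequality one dimension below compares the slices of
    [u], [v] and [h], and its conclusion is the hypothesis of the
    one-dimensional inequality for the slice integrals. *)
Lemma prekopa_leindler n s t (u v h : 'rV[R]_n -> \bar R) :
  (0 < t)%R -> (0 < s)%R -> (t + s = 1)%R ->
  measurable_fun setT u -> measurable_fun setT v -> measurable_fun setT h ->
  (forall x, 0 <= u x) -> (forall x, 0 <= v x) -> (forall x, 0 <= h x) ->
  (forall x y, gmean_le t s (u x) (v y) (h (t *: x + s *: y)%R)) ->
  gmean_le t s (\int[lebesgue_rV R n]_x u x) (\int[lebesgue_rV R n]_x v x)
    (\int[lebesgue_rV R n]_x h x).
Proof.
move=> t0 s0 ts; elim: n u v h => [|n IHn] u v h mu mv mh u0 v0 h0 uvh.
  rewrite /= !integral_dirac// !diracT !mul1e.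
  by have := uvh 0%R 0%R; rewrite !scaler0 addr0.
rewrite !integral_lebesgue_rVS//.
have mslice (f : 'rV[R]_n.+1 -> \bar R) : measurable_fun setT f ->
    forall x, measurable_fun [set: 'rV[R]_n] (fun v => f (rV_cons (x, v))).
  move=> mf x; apply: (measurableT_comp mf).
  by apply: (measurableT_comp (@measurable_rV_cons R n)); exact: measurable_pair1.
apply: prekopa_leindler_line => //.
- apply: (measurable_fun_fubini_tonelli_F (h \o @rV_cons R n)) => //.
    exact: (measurableT_comp mh (@measurable_rV_cons R n)).
  by move=> x; exact: h0.
- by move=> x; exact: integral_ge0.
- by move=> x; exact: integral_ge0.
- by move=> x; exact: integral_ge0.
- move=> x y; apply: (IHn _ _ (fun v => h (rV_cons (t * x + s * y, v)%R))) => //;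
    try exact: mslice.
  by move=> a b; rewrite rV_cons_comb; exact: uvh.
Qed.

End prekopa_leindler.

(** * The Euclidean norm and the uniform convexity of its powers *)

Section euclidean_norm.
Context {R : realType} {n : nat}.
Implicit Types (x y v w m : 'rV[R]_n) (r a b t s : R).

Definition dotp x y : R := \sum_(i < n) x ord0 i * y ord0 i.

Lemma enorm_ge0 x : 0 <= enorm x.
Proof. exact: sqrtr_ge0. Qed.

Lemma enorm_sqr x : enorm x ^+ 2 = dotp x x.
Proof. by rewrite sqr_sqrtr// sumr_ge0// => i _; exact: sqr_ge0. Qed.

Lemma dotpC x y : dotp x y = dotp y x.
Proof. by apply: eq_bigr => i _; rewrite mulrC. Qed.

Lemma dotpDl x y v : dotp (x + y) v = dotp x v + dotp y v.
Proof. by rewrite -big_split; apply: eq_bigr => i _; rewrite mxE mulrDl. Qed.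

Lemma dotpZl a x v : dotp (a *: x) v = a * dotp x v.
Proof. by rewrite mulr_sumr; apply: eq_bigr => i _; rewrite mxE mulrA. Qed.

Lemma dotpDr x y v : dotp v (x + y) = dotp v x + dotp v y.
Proof. by rewrite !(dotpC v) dotpDl. Qed.

Lemma dotpZr a x v : dotp v (a *: x) = a * dotp v x.
Proof. by rewrite !(dotpC v) dotpZl. Qed.

Lemma enormZ a x : enorm (a *: x) = `|a| * enorm x.
Proof.
apply/eqP; rewrite -(@eqrXn2 _ 2)// ?mulr_ge0 ?enorm_ge0// exprMn.
by rewrite real_normK ?num_real// !enorm_sqr dotpZl dotpZr mulrA.
Qed.

Lemma dotp_le_enorm x y : dotp x y <= enorm x * enorm y.
Proof.
have dot0 (z w : 'rV[R]_n) : enorm z = 0 -> dotp z w = 0.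
  move=> z0; apply: big1 => i _.
  have /eqP := enorm_sqr z; rewrite z0 expr0n /= eq_sym psumr_eq0.
    by move=> /allP/(_ i (mem_index_enum _)); rewrite -expr2 sqrf_eq0 => /eqP->; rewrite mul0r.
  by move=> j _; rewrite -expr2 sqr_ge0.
have [x0|x0] := eqVneq (enorm x) 0; first by rewrite dot0// x0 mul0r.
have [y0|y0] := eqVneq (enorm y) 0; first by rewrite dotpC dot0// y0 mulr0.
have xy0 : 0 < enorm x * enorm y.
  by rewrite mulr_gt0// lt_neqAle eq_sym ?x0 ?y0 enorm_ge0.
have := sqr_ge0 (enorm (enorm y *: x - enorm x *: y)).
rewrite enorm_sqr -scaleNr !(dotpDl, dotpDr, dotpZl, dotpZr) (dotpC y x) -!enorm_sqr.
move=> h; rewrite -subr_ge0 -(pmulr_rge0 _ xy0).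
rewrite -(pmulr_rge0 _ (ltr0n R 2))//; apply: le_trans h _.
by rewrite le_eqVlt; apply/orP; left; apply/eqP; ring.
Qed.

Lemma ler_enormD x y : enorm (x + y) <= enorm x + enorm y.
Proof.
rewrite -ler_sqr ?nnegrE ?addr_ge0 ?enorm_ge0// sqrrD !enorm_sqr dotpDl !dotpDr.
by rewrite (dotpC y x); have := dotp_le_enorm x y; lra.
Qed.

End euclidean_norm.

Section uniform_convexity.
Context {R : realType}.
Implicit Types (r a b t s : R).

(** Each of [x = a, b] satisfies [x `^ r <= x / (a + b) * (a + b) `^ r],
    because [x / (a + b)] is at most 1. *)
Lemma powR_superadditive r a b : 1 <= r -> 0 <= a -> 0 <= b ->
  a `^ r + b `^ r <= (a + b) `^ r.
Proof.
move=> r1 a0 b0; have r0 : 0 < r by exact: lt_le_trans r1.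
have [->|an0] := eqVneq a 0; first by rewrite powR0 ?gt_eqF// !add0r.
have [->|bn0] := eqVneq b 0; first by rewrite powR0 ?gt_eqF// !addr0.
have ap : 0 < a by rewrite lt_neqAle eq_sym an0.
have bp : 0 < b by rewrite lt_neqAle eq_sym bn0.
have c0 : 0 < a + b by rewrite addr_gt0.
have share x : 0 < x -> x <= a + b -> x `^ r <= x / (a + b) * (a + b) `^ r.
  move=> x0 xab; rewrite -[in leLHS](divfK (lt0r_neq0 c0) x).
  apply: ge1r_powRZ => //; last exact: ltW.
  by rewrite divr_gt0//= ler_pdivrMr// mul1r.
have := share a ap; have := share b bp.
rewrite lerDl lerDr => /(_ a0) h1 /(_ b0) h2.
apply: le_trans (lerD h2 h1) _; rewrite -mulrDl -mulrDl divff ?mul1r//.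
exact: lt0r_neq0.
Qed.

(** Young's inequality for [b] and [a `^ (r - 1)], with the conjugate exponents
    [r] and [r / (r - 1)], rearranged. *)
Lemma powR_tangent r a b : 1 <= r -> 0 <= a -> 0 <= b ->
  a `^ r + r * a `^ (r - 1) * (b - a) <= b `^ r.
Proof.
rewrite le_eqVlt => /orP[/eqP <-|r1] a0 b0.
  by rewrite subrr powRr0 !powRr1// mulr1 mul1r addrC subrK.
have r0 : 0 < r by exact: lt_trans r1.
have := @conjugate_powR R b (a `^ (r - 1)) r (r / (r - 1)) b0 (powR_ge0 _ _) r0.
rewrite divr_gt0 ?subr_gt0// => /(_ isT).
have r10 : r - 1 != 0 by rewrite subr_eq0 gt_eqF.
rewrite -powRrM [_ * (r / _)]mulrC divfK// => h.
have {h} : b * a `^ (r - 1) <= b `^ r / r + a `^ r / (r / (r - 1)).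
  by apply: h; field; rewrite ?r10 gt_eqF.
rewrite -(ler_pM2l r0) => h.
have : r * (b `^ r / r + a `^ r / (r / (r - 1))) = b `^ r + (r - 1) * a `^ r.
  by field; rewrite ?r10 gt_eqF.
have := mulr_powRB1 a0 r0.
move: h => /[swap] + /[swap] -> => <-; lra.
Qed.

Context {n : nat}.
Implicit Types (x y v w m : 'rV[R]_n).

Let sqnorm_tangent r m w : 1 <= r ->
  (enorm m ^+ 2) `^ r + 2 * r * (enorm m ^+ 2) `^ (r - 1) * dotp m w
    <= (enorm (m + w) ^+ 2) `^ r.
Proof.
move=> r1; apply: le_trans (powR_tangent r1 _ _) => /=; last 2 first.
  exact: (sqr_ge0 (enorm m)).
  exact: sqr_ge0.
rewrite lerD2l; have -> : enorm (m + w) ^+ 2 - enorm m ^+ 2 = 2 * dotp m w + enorm w ^+ 2.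
  by rewrite !enorm_sqr dotpDl !dotpDr (dotpC w m); ring.
have : 0 <= r * (enorm m ^+ 2) `^ (r - 1) * enorm w ^+ 2.
  apply: mulr_ge0; last exact: sqr_ge0.
  by apply: mulr_ge0; [lra|exact: powR_ge0].
lra.
Qed.

(** The parallelogram identity expresses the mean of the squared norms of
    [m + v] and [m] as the sum of those of [m + v / 2] and [v / 2]. Convexity
    and superadditivity of the power [r >= 1] carry this over to the powers,
    and the tangent inequality at [m] applies to [m + v / 2]. *)
Let sqnorm_uniform_tangent r m v : 1 <= r ->
  (enorm m ^+ 2) `^ r + 2 * r * (enorm m ^+ 2) `^ (r - 1) * dotp m v
    + 2 * (enorm (2^-1 *: v) ^+ 2) `^ r <= (enorm (m + v) ^+ 2) `^ r.
Proof.
move=> r1.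
have := sqnorm_tangent m (2^-1 *: v) r1; rewrite dotpZr.
set A := enorm m ^+ 2; set B := enorm (m + v) ^+ 2; set H := enorm (m + _) ^+ 2.
set V := enorm (_ *: v) ^+ 2.
have [A0 B0 H0 V0] : [/\ 0 <= A, 0 <= B, 0 <= H & 0 <= V] by rewrite !sqr_ge0.
have AB : (A + B) / 2 = H + V.
  rewrite /A /B /H /V !enorm_sqr !(dotpDl, dotpDr, dotpZl, dotpZr) (dotpC v m).
  by field.
have := powR_superadditive r1 H0 V0; rewrite -AB => h1 h2.
have M0 : 0 <= (A + B) / 2 by rewrite divr_ge0// addr_ge0.
have := powR_tangent r1 M0 A0; have := powR_tangent r1 M0 B0.
clearbody A B H V; set P := r * _; lra.
Qed.

(** The tangent inequality at the combination [m], taken at the points [x] and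
    [y]: the linear terms cancel, and the remainders keep a factor [s], which
    raising the strong convexity of the squared norm to the power [p / 2]
    would turn into [s `^ (p / 2)]. The linear order in [s] is what makes the
    entropy appear as [s] tends to 0. The factor [1 / 4] comes from the
    halving of [v] in the tangent inequality and from [2^-1 <= t]. *)
Lemma power_potential_uniformly_convex p t s x y : 2 <= p ->
  2^-1 <= t -> 0 <= s -> t + s = 1 ->
  power_potential p (t *: x + s *: y) + s * ((enorm (x - y) / 4) `^ p / p) <=
  t * power_potential p x + s * power_potential p y.
Proof.
move=> p2 t2 s0 ts; have p0 : 0 < p by exact: lt_le_trans p2.
rewrite /power_potential -(ler_pM2r p0) !mulrDl -!mulrA !mulVf ?gt_eqF// !mulr1.
pose r := p / 2; have r1 : 1 <= r by rewrite /r; lra.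
have pE a : 0 <= a -> a `^ p = (a ^+ 2) `^ r.
  by move=> a0; rewrite -powR_mulrn// -powRrM /r mulrC divfK.
rewrite !pE ?divr_ge0 ?enorm_ge0//.
set m := t *: x + s *: y; set d := x - y.
have -> : x = m + s *: d.
  rewrite /m /d scalerBr [t *: x + _]addrC -addrA [_ + (s *: x - _)]addrA.
  by rewrite -scalerDl ts scale1r addrC subrK.
have -> : y = m + (- t) *: d.
  rewrite /m /d scaleNr scalerBr opprB [t *: y - _]addrC addrACA subrr add0r.
  by rewrite -scalerDl [s + t]addrC ts scale1r.
have := sqnorm_uniform_tangent m (s *: d) r1.
have := sqnorm_uniform_tangent m (- t *: d) r1.
rewrite !dotpZr !scalerA.
set A := (enorm m ^+ 2) `^ r; set D := dotp m d.
set U := (enorm (m + s *: d) ^+ 2) `^ r; set V := (enorm (m + _ *: d) ^+ 2) `^ r.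
set K := 2 * r * _; set E := (enorm (_ *: d) ^+ 2) `^ r.
set F := (enorm (_ *: d) ^+ 2) `^ r; set G := ((_ / 4) ^+ 2) `^ r.
move=> hV hU.
have F0 : 0 <= F by exact: powR_ge0.
have GE : G <= E.
  rewrite /G /E ge0_ler_powR ?nnegrE ?sqr_ge0//; first lra.
  rewrite ler_sqr ?nnegrE ?divr_ge0 ?enorm_ge0// enormZ mulrC ler_wpM2r ?enorm_ge0//.
  by rewrite mulrN normrN ger0_norm; lra.
have t0 : 0 < t by lra.
have := ler_wpM2l (ltW t0) hU; have := ler_wpM2l s0 hV; have := ler_wpM2l s0 GE.
have := mulr_ge0 (ltW t0) F0; have := mulr_ge0 s0 (powR_ge0 _ _ : 0 <= G).
have -> : A = t * A + s * A by rewrite -mulrDl ts mul1r.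
nra.
Qed.

End uniform_convexity.

(** * Borel sets, Heine's theorem and densities *)

Section borel_rV.
Context {R : realType} {n : nat}.
Implicit Types (x y : 'rV[R]_n).

(** An open set is the union of the open boxes with a rational centre and a
    half-side [1 / (k + 1)] that it contains, a countable union. *)
Lemma open_measurable_rV (U : set 'rV[R]_n) : open U -> measurable U.
Proof.
move=> oU.
pose box (c : 'rV[rat]_n * nat) : set 'rV[R]_n :=
  [set x | forall i, `|x ord0 i - ratr (c.1 ord0 i)| < c.2.+1%:R^-1].
have mbox c : measurable (box c).
  rewrite (_ : box c = \bigcap_(i in [set: 'I_n])
    [set x | `|x ord0 i - ratr (c.1 ord0 i)| < c.2.+1%:R^-1]).
    apply: fin_bigcap_measurable; first exact: finite_finset.
    move=> i _; rewrite -[X in measurable X]setTI.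
    have mf : measurable_fun [set: 'rV[R]_n] (fun x => `|x ord0 i - ratr (c.1 ord0 i)|).
      apply: measurableT_comp => //; apply: measurable_funB => //.
      exact: (@measurable_coord _ R n i).
    move: (mf measurableT _ (measurable_itv `]-oo, c.2.+1%:R^-1[)).
    by congr measurable; apply/seteqP; split => x /=; rewrite in_itv.
  by apply/seteqP; split => [x h i _|x h i]; [exact: h|exact: (h i I)].
rewrite (_ : U = \bigcup_c (if pselect (box c `<=` U) then box c else set0)).
  apply: countable_bigcupT_measurable => [|c]; last first.
    by case: pselect => _ /=; [exact: mbox|exact: measurable0].
  exact: countableP.
apply/seteqP; split => [x Ux|x [c _]]; last by case: pselect => //= cU /cU.
have /nbhs_ballP[e /= e0 xeU] : nbhs x U by exact: open_nbhs_nbhs.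
have [k ke] : exists k : nat, k.+1%:R^-1 + k.+1%:R^-1 < e.
  have e20 : 0 < e / 2 by rewrite divr_gt0.
  have [k _ /(_ k (leqnn _)) /= ke] := near_infty_natSinv_lt (PosNum e20).
  by exists k; rewrite [ltRHS](splitr e) ltrD.
have xq i : exists q : rat, `|x ord0 i - ratr q| < k.+1%:R^-1.
  have : x ord0 i - k.+1%:R^-1 < x ord0 i + k.+1%:R^-1.
    by rewrite ltrBlDr -addrA ltrDl addr_gt0// invr_gt0.
  move=> /rat_in_itvoo[q]; rewrite in_itv/= => /andP[h1 h2].
  by exists q; rewrite ltr_distlC h1.
have [q qx] := choice xq.
exists (\row_i q i, k) => //; case: pselect => /= [_ i|].
  by rewrite mxE.
move=> abs; exfalso; apply: abs => y /= hy; apply: xeU; split => // i j; rewrite ord1 /ball /=.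
have := hy j; rewrite mxE => hyj; apply: lt_trans ke.
rewrite -[x _ _](subrK (ratr (q j))) -addrA (le_lt_trans (ler_normD _ _))//.
by rewrite ltrD// distrC.
Qed.

Lemma continuous_measurable_rV (f : 'rV[R]_n -> R) :
  continuous f -> measurable_fun setT f.
Proof.
move=> /continuousP cf; apply: (measurability _ (RGenOpens.measurableE R)) => //.
move=> _ [_ [a [b ->]] <-]; rewrite setTI; apply: open_measurable_rV.
by apply: cf; exact: interval_open.
Qed.

Lemma continuous_enorm : continuous (@enorm R n).
Proof.
move=> x; apply: continuous_comp; last exact: sqrt_continuous.
have -> : (fun x : 'rV[R]_n => \sum_(i < n) x ord0 i ^+ 2) =
    \sum_(i < n) (fun x : 'rV[R]_n => x ord0 i ^+ 2).
  by apply/funext => y; rewrite fct_sumE.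
elim/big_ind : _ => [|f g cf cg|i _]; first exact: cst_continuous.
  exact: continuousD.
by apply: (@continuousM R 'rV[R]_n); exact: coord_continuous.
Qed.

Lemma norm_le_enorm x : `|x| <= enorm x.
Proof.
rewrite [leLHS]/Num.Def.normr/= mx_normrE (bigmax_le _ (enorm_ge0 _))//= => -[i j] _ /=.
rewrite ord1 -ler_sqr ?nnegrE ?enorm_ge0// real_normK ?num_real//.
rewrite enorm_sqr /dotp (bigD1 j)//= -expr2 lerDl sumr_ge0// => k _.
by rewrite -expr2 sqr_ge0.
Qed.

Lemma compact_enorm_le (r : R) : compact [set x : 'rV[R]_n | enorm x <= r].
Proof.
apply: bounded_closed_compact.
  exists r; split; first exact: num_real.
  by move=> r' rr' x /= xr; apply: le_trans (norm_le_enorm _) (le_trans xr (ltW rr')).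
rewrite (_ : mkset _ = @enorm R n @^-1` `]-oo, r]%classic).
  apply: preimage_closed; last exact: interval_closed.
  by move=> x _; exact: continuous_enorm.
by apply/seteqP; split => x /=; rewrite in_itv.
Qed.

(** Heine's theorem on the compact ball of radius [r]. For two points that are
    not both outside of the ball, one may start from the one inside. *)
Lemma unif_continuous_compact_support (f : 'rV[R]_n -> R) (r e : R) :
  continuous f -> (forall x, r <= enorm x -> f x = 0) -> 0 < e ->
  exists2 d, 0 < d & forall x y, enorm (x - y) < d -> `|f x - f y| < e.
Proof.
move=> cf f0 e0; have /compact_near_coveringP := @compact_enorm_le r.
move=> /(_ _ (0^'+) (fun d x => forall y, enorm (x - y) < d -> `|f x - f y| < e)).
have H x : [set x : 'rV[R]_n | enorm x <= r] x -> \forall x' \near x & d \near 0^'+,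
    forall y, enorm (x' - y) < d -> `|f x' - f y| < e.
  move=> _; have /cvgrPdist_lt/(_ (e / 2)) := cf x.
  rewrite divr_gt0// => /(_ isT)/nbhs_ballP[rho /= rho0 xf].
  exists (ball x (rho / 2), [set d | d < rho / 2]) => /=.
    split; first by apply: nbhsx_ballx; rewrite divr_gt0.
    by apply: nbhs_right_lt; rewrite divr_gt0.
  move=> [x' d] [/= xx' drho] y x'y.
  have xy : ball x rho y.
    rewrite (splitr rho); apply: ball_triangle xx' _.
    rewrite mx_norm_ball /ball_ /=; apply: le_lt_trans (norm_le_enorm _) _.
    exact: lt_trans drho.
  have {}xx' : ball x rho x'.
    by apply: le_ball xx'; rewrite ler_pdivrMr// ler_peMr ?ler1n// ltW.
  have := xf _ xy; have := xf _ xx'; rewrite /= => h1 h2.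
  rewrite -(subrK (f x) (f x')) -addrA (le_lt_trans (ler_normD _ _))// (splitr e).
  by rewrite ltrD// distrC.
move=> /(_ _ H) [d /= d0 Hd].
have unif x y : enorm x <= r -> enorm (x - y) < d / 2 -> `|f x - f y| < e.
  move=> xr; apply: (Hd (d / 2)) => //; last by rewrite divr_gt0.
  by rewrite /ball_ /= sub0r normrN gtr0_norm ?divr_gt0// ltr_pdivrMr// ltr_pMr// ltr1n.
exists (d / 2) => [|x y xy]; first by rewrite divr_gt0.
have [xr|/ltW xr] := leP (enorm x) r; first exact: unif.
have [yr|/ltW yr] := leP (enorm y) r; last by rewrite !f0// subrr normr0.
by rewrite distrC; apply: unif; rewrite // -opprB -scaleN1r enormZ normrN1 mul1r.
Qed.

End borel_rV.

Section density.
Local Open Scope ereal_scope.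
Context d (T : measurableType d) (R : realType).
Variables (mu nu : {measure set T -> \bar R}) (k : T -> R).
Hypothesis mk : measurable_fun setT k.
Hypothesis k0 : forall x, (0 <= k x)%R.
Hypothesis nuE : forall A, measurable A -> nu A = \int[mu]_(x in A) (k x)%:E.

Import HBNNSimple.

Lemma ge0_integral_density (f : T -> \bar R) : measurable_fun setT f ->
  (forall x, 0 <= f x) -> \int[nu]_x f x = \int[mu]_x (f x * (k x)%:E).
Proof.
move=> mf f0.
pose f_ := nnsfun_approx measurableT mf.
transitivity (limn (fun n => \int[nu]_x (f_ n x)%:E)).
  rewrite -monotone_convergence//.
  - apply: eq_integral => y _; apply/esym/cvg_lim => //.
    by apply: cvg_nnsfun_approx.
  - by move=> n; exact/measurable_EFinP/measurable_funP.
  - by move=> n y _; rewrite lee_fin.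
  - by move=> y _ m n mn; rewrite lee_fin; exact/lefP/nd_nnsfun_approx.
rewrite [X in limn X](_ : _ =
    (fun n => \int[mu]_x ((f_ n x)%:E * (k x)%:E))).
  rewrite -monotone_convergence//.
  - apply: eq_integral => x _ /=; apply/cvg_lim => //.
    apply: cvgeZr => //; exact: cvg_nnsfun_approx.
  - move=> n; apply/measurable_EFinP; apply: measurable_funM => //.
  - by move=> n x _ /=; rewrite lee_fin mulr_ge0.
  - move=> x _ m n mn; rewrite lee_fin ler_wpM2r//; exact/lefP/nd_nnsfun_approx.
apply/funext => n.
transitivity (\sum_(r \in range (f_ n))
    \int[nu]_x (r * \1_(f_ n @^-1` [set r]) x)%:E).
  rewrite -ge0_integral_fsum//.
  - by apply: eq_integral => x _; rewrite fsumEFin// -fimfunE.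
  - by move=> r; exact/measurable_EFinP/measurable_funM.
  - by move=> r x _; rewrite nnfun_muleindic_ge0.
transitivity (\sum_(r \in range (f_ n))
    \int[mu]_x ((r * \1_(f_ n @^-1` [set r]) x)%:E * (k x)%:E)).
  apply: eq_fsbigr => r /set_mem[x _ <-].
  rewrite integralZl_indic_nnsfun// integral_indic// setIT nuE//.
  under [RHS]eq_integral do rewrite EFinM -muleA.
  rewrite ge0_integralZl//; last 3 first.
  - by apply/measurable_EFinP; exact: measurable_funM.
  - by move=> y _; rewrite lee_fin mulr_ge0.
  - by rewrite lee_fin.
  congr (_ * _); rewrite integral_mkcond; apply: eq_integral => y _.
  by rewrite patchE indicE; case: (y \in _); rewrite ?mul1e ?mul0e.
rewrite -ge0_integral_fsum//.
- apply: eq_integral => x _.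
  rewrite -ge0_mule_fsuml ?fsumEFin// -?fimfunE//.
  by move=> r; rewrite nnfun_muleindic_ge0.
- move=> r; apply/measurable_EFinP; apply: measurable_funM => //.
  exact: measurable_funM.
- move=> r x _; apply: mule_ge0; last by rewrite lee_fin.
  exact: nnfun_muleindic_ge0.
Qed.

End density.

(** * Gradients and first-order growth *)

Section gradient_calculus.
Context {R : realType} {n : nat}.
Implicit Types (x y v w z : 'rV[R]_n) (f g : 'rV[R]_n -> R).

Lemma derive_dotp g x w : differentiable g x -> 'D_w g x = dotp (gradient g x) w.
Proof.
move=> dg; rewrite deriveE// [in LHS](row_sum_delta w) linear_sum.
by apply: eq_bigr => i _; rewrite linearZ mxE deriveE// mulrC.
Qed.

Lemma gradient_eq g x v : differentiable g x ->
  (forall w, 'D_w g x = dotp v w) -> gradient g x = v.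
Proof.
move=> dg H; apply/rowP => i; rewrite mxE H /dotp (bigD1 i)//= mxE !eqxx mulr1.
by rewrite big1 ?addr0// => j ji; rewrite mxE (negPf ji) andbF mulr0.
Qed.

Lemma differentiable_gradient_comp (phi : R -> R) (a : R) g x :
  is_derive (g x) 1 phi a -> differentiable g x ->
  differentiable (phi \o g) x /\ gradient (phi \o g) x = a *: gradient g x.
Proof.
move=> [/derivable1_diffP dphi phiE] dg.
have dc : differentiable (phi \o g) x by exact: differentiable_comp.
split=> //; apply: gradient_eq => // w.
rewrite deriveE// diff_comp//= dotpZl -derive_dotp// deriveE//.
by rewrite diff1E// derive1E phiE mulrC.
Qed.

Lemma differentiable_gradient_mul f g x :
  differentiable f x -> differentiable g x ->
  differentiable (f \* g) x /\
  gradient (f \* g) x = f x *: gradient g x + g x *: gradient f x.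
Proof.
move=> df dg; have dc : differentiable (f \* g) x by exact: differentiableM.
split=> //; apply: gradient_eq => // w.
rewrite (_ : f \* g = f * g)// deriveM; [|exact: diff_derivable..].
by rewrite !derive_dotp// dotpDl !dotpZl.
Qed.

Lemma differentiable_gradient_sqr_enorm x :
  differentiable (fun x => enorm x ^+ 2) x /\
  gradient (fun x => enorm x ^+ 2) x = 2 *: x.
Proof.
have -> : (fun x => enorm x ^+ 2) = \sum_(i < n) (fun x => x ord0 i ^+ 2).
  apply/funext => y; rewrite enorm_sqr fct_sumE.
  by apply: eq_bigr => i _; rewrite expr2.
have dsq i : differentiable (fun x => x ord0 i ^+ 2) x.
  apply: (@differentiableX _ _ (fun x : 'rV[R]_n => x ord0 i) 1).
  exact: differentiable_coord.
have dc : differentiable (\sum_(i < n) (fun x => x ord0 i ^+ 2)) x.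
  exact: differentiable_sum.
split=> //; apply: gradient_eq => // w.
rewrite derive_sum; last by move=> i; exact: diff_derivable.
rewrite dotpZl mulr_sumr; apply: eq_bigr => i _.
have dcoord : derivable (fun x : 'rV[R]_n => x ord0 i) x w.
  exact/diff_derivable/differentiable_coord.
have coordE : 'D_w (fun x : 'rV[R]_n => x ord0 i) x = w ord0 i.
  have := derive_mx (@derivable_id R 'rV[R]_n x w); rewrite derive_id => /matrixP/(_ ord0 i).
  by rewrite mxE => <-.
rewrite (_ : (fun _ => _ ^+ 2) = (fun x : 'rV[R]_n => x ord0 i) ^+ 2)//.
by rewrite deriveX// coordE /= expr1 mulrA.
Qed.

Lemma mean_value g (s : R) z w : (forall x, differentiable g x) -> 0 <= s ->
  exists2 c, 0 <= c <= s &
    g (z + s *: w) - g z = s * dotp (gradient g (z + c *: w)) w.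
Proof.
move=> dg s0.
have dl (c : R) : is_derive c 1 (fun r => g (z + r *: w)) (dotp (gradient g (z + c *: w)) w).
  have dg' : derivable g (z + c *: w) w by exact/diff_derivable/dg.
  have E : (fun h : R => h^-1 *: (g (z + (h *: (1 : R) + c) *: w) - g (z + c *: w))) =
           (fun h : R => h^-1 *: (g (h *: w + (z + c *: w)) - g (z + c *: w))).
    apply/funext => h; congr (_ *: (g _ - _)).
    by rewrite [h *: _]mulr1 scalerDl addrCA.
  split; first by rewrite /derivable E; exact: dg'.
  by rewrite -derive_dotp// /derive E.
have [|c] := @MVT_segment R (fun r => g (z + r *: w))
    (fun c => dotp (gradient g (z + c *: w)) w) 0 s s0.
- apply: continuous_subspaceT => c; apply: differentiable_continuous.
  by apply/derivable1_diffP; case: (dl c).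
- by rewrite in_itv/= scale0r addr0 subr0 mulrC => csE ->; exists c.
Qed.

(** The increment of [g] is at most [s |w|] times the norm of the gradient at some
    point of the segment. If [s |w|] is small, uniform continuity compares
    this gradient with the one at [z], and Young's inequality splits the
    product. Otherwise, as [s] is small, [|w|] is so large that
    [(|w| / 4)^p / p] dominates [L |w|]; this uses [p >= 2]. *)
Lemma growth_bound (p q L e : R) g : 2 <= p -> 0 < q -> p^-1 + q^-1 = 1 -> 0 < e ->
  (forall x, differentiable g x) ->
  (forall x, enorm (gradient g x) <= L) ->
  (forall e', 0 < e' -> exists2 d, 0 < d & forall x y, enorm (x - y) < d ->
     enorm (gradient g y) <= enorm (gradient g x) + e') ->
  exists2 s0, 0 < s0 & forall s z w, 0 < s -> s < s0 ->
    g (z + s *: w) <= g z + s * ((enorm w / 4) `^ p / p +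
                                (4 * (enorm (gradient g z) + e)) `^ q / q).
Proof.
move=> p2 q0 pq e0 dg gL /(_ e e0)[d d0 gd].
have p0 : 0 < p by exact: lt_le_trans p2.
(* Beyond W, 1 <= |w| / 4, and L |w| is at most (|w| / 4)^2 / p. *)
pose W := Num.max 4 (16 * p * L).
have W0 : 0 < W by rewrite lt_max ltr0n.
exists (d / W) => [|s z w s0 ss]; first by rewrite divr_gt0.
have [c /andP[c0 cs] E] := mean_value z w dg (ltW s0).
rewrite -lerBlDl E ler_pM2l//; apply: le_trans (dotp_le_enorm _ _) _.
have [swd|swd] := ltP (s * enorm w) d.
  have cw : enorm (z - (z + c *: w)) < d.
    rewrite opprD addrA subrr add0r -scaleNr enormZ normrN ger0_norm//.
    by apply: le_lt_trans swd; rewrite ler_wpM2r// enorm_ge0.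
  apply: (@le_trans _ _ (enorm w / 4 * (4 * (enorm (gradient g z) + e)))).
    rewrite mulrA divfK// mulrC ler_wpM2l ?enorm_ge0//.
    exact: gd cw.
  by apply: conjugate_powR; rewrite ?divr_ge0 ?mulr_ge0 ?addr_ge0 ?enorm_ge0 ?(ltW e0).
have Ww : W <= enorm w.
  rewrite -(ler_pM2l s0); apply: le_trans swd.
  by rewrite -ler_pdivlMr// ltW.
apply: (@le_trans _ _ (L * enorm w)); first by rewrite ler_wpM2r// enorm_ge0.
apply: ler_wpDr; first by rewrite divr_ge0 ?powR_ge0 ?ltW.
move: Ww; rewrite /W ge_max => /andP[w4 wL].
rewrite ler_pdivlMr//; apply: (@le_trans _ _ ((enorm w / 4) ^+ 2)).
  have := ler_wpM2r (enorm_ge0 w) wL; lra.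
rewrite -powR_mulrn ?divr_ge0 ?enorm_ge0// ler_powR// ler_pdivlMr// mul1r//.
Qed.

End gradient_calculus.

(** * The Gibbs measure *)

(** The definition of [gmean_le] applies to [r a] and [r b] for all [r < 1]. *)
Lemma gmean_le_fin (R : realType) (t s a b c : R) : t + s = 1 -> 0 < a -> 0 < b ->
  gmean_le t s a%:E b%:E c%:E -> a `^ t * b `^ s <= c.
Proof.
move=> ts a0 b0 abc; set X := _ * _; have X0 : 0 < X by rewrite mulr_gt0 ?powR_gt0.
have scaled r : 0 < r -> r < 1 -> r * X <= c.
  move=> r0 r1; have := abc (r * a) (r * b) (mulr_gt0 r0 a0) (mulr_gt0 r0 b0).
  rewrite !lte_fin !gtr_pMl// => /(_ r1 r1); rewrite lee_fin.
  rewrite (powRM t (ltW r0) (ltW a0)) (powRM s (ltW r0) (ltW b0)) mulrACA.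
  by rewrite -powRD ?ts ?oner_eq0// powRr1 ?(ltW r0).
rewrite leNgt; apply/negP => cX.
have c0 : 0 <= c.
  apply: le_trans (scaled 2^-1 _ _); rewrite ?invr_gt0 ?invf_lt1 ?ltr1n//.
  by apply: mulr_ge0; [rewrite invr_ge0|exact: ltW].
have X20 : 0 < 2 * X by rewrite mulr_gt0.
have r0 : 0 < (c + X) / (2 * X) by rewrite divr_gt0// ltr_wpDl.
have r1 : (c + X) / (2 * X) < 1 by rewrite ltr_pdivrMr//; lra.
have := scaled _ r0 r1.
have -> : (c + X) / (2 * X) * X = (c + X) / 2 by field; rewrite gt_eqF.
lra.
Qed.

Section gibbs.
Context {R : realType} {n : nat} (Phi : {mfun 'rV[R]_n >-> R}).
Local Notation Z := (partition_function Phi).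
Local Notation mu := (gibbs_measure Phi).
Hypothesis Z0 : Z != 0.

Lemma partition_function_gt0 : 0 < Z.
Proof.
rewrite lt_neqAle eq_sym Z0; apply: Rintegral_ge0 => x _; exact: expR_ge0.
Qed.

Let measurable_weight : measurable_fun setT (fun x => expR (- Phi x)).
Proof. by apply: measurableT_comp => //; exact: measurableT_comp. Qed.

Lemma integral_weight : (\int[lebesgue_rV R n]_x (expR (- Phi x))%:E)%E = Z%:E.
Proof.
rewrite /partition_function /Rintegral fineK// ge0_fin_numE; last first.
  by apply: integral_ge0 => x _; rewrite lee_fin expR_ge0.
rewrite ltNge leye_eq; apply/negP => /eqP H; move/eqP: Z0; apply.
by rewrite /partition_function /Rintegral H.
Qed.

Lemma integral_gibbs (f : 'rV[R]_n -> R) : measurable_fun setT f ->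
  (forall x, 0 <= f x) ->
  (\int[lebesgue_rV R n]_x (f x * expR (- Phi x))%:E =
   Z%:E * \int[mu]_x (f x)%:E)%E.
Proof.
move=> mf f0; have Zp := partition_function_gt0.
rewrite (@ge0_integral_density _ _ _ (lebesgue_rV R n) mu
  (fun x => expR (- Phi x) / Z))//; last 3 first.
- exact: measurable_funM.
- by move=> x; rewrite divr_ge0 ?expR_ge0 ?ltW.
- exact/measurable_EFinP.
rewrite -ge0_integralZl//; last 3 first.
- apply/measurable_EFinP; apply: measurable_funM => //; exact: measurable_funM.
- by move=> x _; rewrite -EFinM lee_fin mulr_ge0// divr_ge0 ?expR_ge0 ?ltW.
- by rewrite lee_fin ltW.
apply: eq_integral => x _; rewrite -!EFinM; congr (_%:E).
by field; rewrite gt_eqF.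
Qed.

Lemma gibbs_measureT : mu setT = 1%E.
Proof.
have Zp := partition_function_gt0.
rewrite /gibbs_measure; under eq_integral do rewrite mulrC EFinM.
rewrite ge0_integralZl//; last 2 first.
- exact/measurable_EFinP.
- by rewrite lee_fin invr_ge0 ltW.
by rewrite integral_weight -EFinM mulVf.
Qed.

Lemma bounded_gibbs_integrable (f : 'rV[R]_n -> R) (M : R) :
  measurable_fun setT f -> (forall x, `|f x| <= M) ->
  mu.-integrable setT (EFin \o f).
Proof.
move=> mf fM; apply: measurable_bounded_integrable => //.
  by rewrite [ltLHS]gibbs_measureT ltry.
by exists M; split; [exact: num_real|move=> M' MM' x _; exact: le_trans (ltW MM')].
Qed.

Lemma EFin_Rintegral_gibbs (f : 'rV[R]_n -> R) : mu.-integrable setT (EFin \o f) ->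
  (\int[mu]_x (f x)%:E = (\int[mu]_x f x)%:E)%E.
Proof. by move=> fi; rewrite /Rintegral fineK// integrable_fin_num. Qed.

(** The inequality of Prekopa and Leindler for the functions [exp (a - Phi)],
    [exp (- Phi)] and [exp (b - Phi)]. The normalisation constants on the two
    sides cancel, since [t + s = 1]. *)
Lemma gibbs_prekopa_leindler t s (a b : 'rV[R]_n -> R) :
  0 < t -> 0 < s -> t + s = 1 ->
  measurable_fun setT a -> measurable_fun setT b ->
  mu.-integrable setT (EFin \o (expR \o a)) ->
  mu.-integrable setT (EFin \o (expR \o b)) ->
  0 < \int[mu]_x expR (a x) ->
  (forall x y, t * a x - (t * Phi x + s * Phi y) <=
     b (t *: x + s *: y) - Phi (t *: x + s *: y)) ->
  (\int[mu]_x expR (a x)) `^ t <= \int[mu]_x expR (b x).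
Proof.
move=> t0 s0 ts ma mb ia ib a0 ab; have Zp := partition_function_gt0.
have mexp (f : 'rV[R]_n -> R) : measurable_fun setT f ->
  measurable_fun setT (fun x => (expR (f x) * expR (- Phi x))%:E).
  by move=> mf; apply/measurable_EFinP/measurable_funM => //; exact: measurableT_comp.
have := @prekopa_leindler R n s t (fun x => (expR (a x) * expR (- Phi x))%:E)
  (fun x => (expR (- Phi x))%:E) (fun x => (expR (b x) * expR (- Phi x))%:E) t0 s0 ts.
rewrite !integral_gibbs ?integral_weight; last 4 first.
- exact: measurableT_comp.
- by move=> x; exact: expR_ge0.
- exact: measurableT_comp.
- by move=> x; exact: expR_ge0.
rewrite !EFin_Rintegral_gibbs// -!EFinM => H.
have {H} : gmean_le t s (Z * \int[mu]_x expR (a x))%:E Z%:E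
    (Z * \int[mu]_x expR (b x))%:E.
  apply: H.
  - exact: mexp.
  - exact/measurable_EFinP.
  - exact: mexp.
  - by move=> x; rewrite lee_fin mulr_ge0 ?expR_ge0.
  - by move=> x; rewrite lee_fin expR_ge0.
  - by move=> x; rewrite lee_fin mulr_ge0 ?expR_ge0.
  move=> x y a' b' a'0 b'0; rewrite !lte_fin lee_fin -!expRD => a'u b'v.
  apply: (@le_trans _ _ (expR (a x - Phi x) `^ t * expR (- Phi y) `^ s)).
    by rewrite ler_pM ?powR_ge0// ge0_ler_powR ?nnegrE ?expR_ge0 ?ltW.
  rewrite -!expRM -expRD ler_expR; have := ab x y; lra.
move=> /gmean_le_fin => /(_ ts (mulr_gt0 Zp a0) Zp).
rewrite (powRM t (ltW Zp) (ltW a0)) mulrAC -powRD ?ts ?oner_eq0// powRr1 ?(ltW Zp)//.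
by rewrite ler_pM2l.
Qed.

End gibbs.

(** * First-order comparison in one real parameter *)

Section first_order.
Context {R : realType}.
Implicit Types (I J K C s : R).

Lemma ler_small_multiple (a E s0 : R) : 0 < s0 ->
  (forall s, 0 < s -> s < s0 -> a <= s * E) -> a <= 0.
Proof.
move=> s00 H; rewrite leNgt; apply/negP => a0.
have E0 : 0 < E.
  have s20 : 0 < s0 / 2 by rewrite divr_gt0.
  rewrite -(pmulr_rgt0 _ s20); apply: lt_le_trans a0 (H _ s20 _).
  by rewrite ltr_pdivrMr// ltr_pMr// ltr1n.
pose s := Num.min (s0 / 2) (a / (2 * E)).
have s_gt0 : 0 < s by rewrite lt_min !divr_gt0// mulr_gt0.
have : s < s0 by rewrite gt_min ltr_pdivrMr// ltr_pMr// ltr1n.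
move=> /(H _ s_gt0); apply/negP; rewrite -ltNge.
have : s * E <= a / (2 * E) * E by rewrite ler_wpM2r ?(ltW E0)// ge_min lexx orbT.
have -> : a / (2 * E) * E = a / 2 by field; rewrite gt_eqF.
lra.
Qed.

Lemma ln_tangent (a x : R) : 0 < a -> 0 < x -> ln x <= ln a + (x / a - 1).
Proof.
move=> a0 x0; rewrite -lerBlDl -ln_div ?posrE//.
have := @le_ln1Dx R (x / a - 1); rewrite addrCA subrr addr0; apply.
by rewrite ltrBrDl subrr divr_gt0.
Qed.

(** [J - I ln I] is the derivative at [s = 0] of the power [1 - s] of
    [I + s / (1 - s) * J], and [K] that of the upper bound; both functions
    take the value [I] at 0. *)
Lemma first_order_comparison (A : R -> R) I J K C s0 : 0 < I -> 0 < s0 ->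
  (forall s, 0 < s -> s < s0 -> s < 1 -> I + s / (1 - s) * J <= A s) ->
  (forall s, 0 < s -> s < s0 -> s < 1 -> A s `^ (1 - s) <= I + s * K + s ^+ 2 * C) ->
  J - I * ln I <= K.
Proof.
move=> I0 s00 AJ AK; set l := ln I; pose k := I * l + K.
suff : I * (J - k) <= 0 by rewrite pmulr_rle0// /k; lra.
pose s1 := Num.min s0 (Num.min 2^-1 (I / (2 * (`|J| + 1)))).
have J1 : 0 < `|J| + 1 by rewrite ltr_wpDl.
have s10 : 0 < s1 by rewrite !lt_min s00 invr_gt0 ltr0n divr_gt0// mulr_gt0.
pose E := `|J * I| + `|C| * (I + `|J - I|) + `|k| * `|J - I|.
apply: (@ler_small_multiple _ E s1 s10) => s s_gt0.
rewrite !lt_min => /and3P[ss0 s2].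
rewrite ltr_pdivlMr ?mulr_gt0// => sI.
have s1' : s < 1 by apply: lt_trans s2 _; rewrite invf_lt1 ?ltr1n.
have t0 : 0 < 1 - s by rewrite subr_gt0.
have sJ : `|s * J| <= I / 2.
  rewrite normrM gtr0_norm//; have := mulr_ge0 (ltW s_gt0) (normr_ge0 J).
  by move: sI; set j := `|J|; nra.
have D0 : 0 < (1 - s) * I + s * J.
  by move: sJ; rewrite ler_norml => /andP[h _]; nra.
have y0 : 0 < I + s / (1 - s) * J.
  have -> : I + s / (1 - s) * J = ((1 - s) * I + s * J) / (1 - s).
    by field; rewrite gt_eqF.
  by rewrite divr_gt0.
have A0 : 0 < A s by exact: lt_le_trans y0 (AJ s s_gt0 ss0 s1').
have R0 : 0 < I + s * K + s ^+ 2 * C.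
  by apply: lt_le_trans (AK s s_gt0 ss0 s1'); exact: powR_gt0.
have up : (1 - s) * ln (I + s / (1 - s) * J) <= l + (s * K + s ^+ 2 * C) / I.
  apply: (@le_trans _ _ ((1 - s) * ln (A s))).
    by rewrite ler_pM2l// ler_ln ?posrE//; exact: AJ.
  rewrite -ln_powR; apply: (@le_trans _ _ (ln (I + s * K + s ^+ 2 * C))).
    by rewrite ler_ln ?posrE ?powR_gt0//; exact: AK.
  apply: le_trans (ln_tangent I0 R0) _; rewrite le_eqVlt; apply/orP; left; apply/eqP.
  by rewrite -/l; field; rewrite gt_eqF.
have low : l + s * J / ((1 - s) * I + s * J) <= ln (I + s / (1 - s) * J).
  have := ln_tangent y0 I0; rewrite -/l.
  have -> : I / (I + s / (1 - s) * J) - 1 = - (s * J / ((1 - s) * I + s * J)).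
    by field; rewrite !gt_eqF.
  lra.
have : (1 - s) * (s * J / ((1 - s) * I + s * J)) <= s * (l + (K + s * C) / I).
  have := le_trans _ up => /(_ _ (ler_wpM2l (ltW t0) low)).
  have -> : (s * K + s ^+ 2 * C) / I = s * ((K + s * C) / I).
    by field; rewrite gt_eqF.
  nra.
have -> : (1 - s) * (s * J / ((1 - s) * I + s * J)) =
   s * ((1 - s) * J / ((1 - s) * I + s * J)) by field; rewrite gt_eqF.
rewrite ler_pM2l// ler_pdivrMr//.
rewrite -(ler_pM2l I0).
have -> : I * ((l + (K + s * C) / I) * ((1 - s) * I + s * J)) =
   (k + s * C) * (I + s * (J - I)) by rewrite /k; field; rewrite gt_eqF.
move=> main.
have h1 : s * (J * I) <= s * `|J * I| by rewrite ler_wpM2l ?(ltW s_gt0)// ler_norm.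
have h2 : s * (k * (J - I)) <= s * (`|k| * `|J - I|).
  by rewrite ler_wpM2l ?(ltW s_gt0)// -normrM ler_norm.
have h3 : s * (C * (I + s * (J - I))) <= s * (`|C| * (I + `|J - I|)).
  rewrite ler_wpM2l ?(ltW s_gt0)//; apply: le_trans (ler_norm _) _.
  rewrite normrM ler_wpM2l//; apply: le_trans (ler_normD _ _) _.
  rewrite gtr0_norm// lerD2l normrM gtr0_norm// ler_piMl//; exact: ltW.
rewrite /E !mulrDr; nra.
Qed.

Lemma expR_quadratic (y : R) : 0 <= y -> y <= 2^-1 -> expR y <= 1 + y + 2 * y ^+ 2.
Proof.
move=> y0 y2; have h1 : 0 < 1 - y by lra.
rewrite -[leLHS]invrK -expRN; apply: (@le_trans _ _ (1 - y)^-1).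
  by rewrite lef_pV2 ?posrE ?expR_gt0// expR_ge1Dx.
rewrite -[leLHS]mul1r ler_pdivrMr//.
have : 0 <= y ^+ 2 * (1 - 2 * y) by rewrite mulr_ge0 ?sqr_ge0//; lra.
nra.
Qed.

End first_order.

(** * The inequality for bounded functions *)

Lemma conjugate_exponent_bounds (R : realType) (p q : R) : 2 <= p ->
  p^-1 + q^-1 = 1 -> 1 <= q <= 2.
Proof.
move=> p2 pq; have p0 : 0 < p by exact: lt_le_trans p2.
have q1 : q^-1 = 1 - p^-1 by rewrite -pq addrAC subrr add0r.
have ip : p^-1 <= 2^-1 by rewrite lef_pV2 ?posrE.
have ip0 : 0 < p^-1 by rewrite invr_gt0.
have iq0 : 0 < q^-1 by rewrite q1; lra.
have q0 : 0 < q by rewrite -invr_gt0.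
apply/andP; split.
  by rewrite -[leLHS]invr1 -[leRHS]invrK lef_pV2 ?posrE// q1; lra.
by rewrite -[leLHS]invrK invf_ple ?posrE// q1; lra.
Qed.

Lemma powR_addl_le (R : realType) (q a b : R) : 0 <= q -> 0 <= a -> 0 <= b ->
  (a + b) `^ q <= 2 `^ q * (a `^ q + b `^ q).
Proof.
move=> q0; wlog ab : a b / a <= b => [H a0 b0|a0 b0].
  have [|/ltW] := leP a b; first by move=> h; exact: H.
  by move=> h; rewrite addrC (addrC (a `^ q)); exact: H.
apply: (@le_trans _ _ ((2 * b) `^ q)).
  by rewrite ge0_ler_powR ?nnegrE ?addr_ge0 ?mulr_ge0//; lra.
by rewrite powRM// ler_wpM2l ?powR_ge0// lerDr powR_ge0.
Qed.

Lemma integrable_scale d (T : measurableType d) (R : realType)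
    (mu : {measure set T -> \bar R}) (k : R) (f : T -> R) :
  mu.-integrable setT (EFin \o f) ->
  mu.-integrable setT (EFin \o (fun x => k * f x)).
Proof.
move=> fi; have := integrableZl measurableT k fi.
by apply: eq_integrable => // x _; rewrite /= EFinM.
Qed.

Lemma integrable_add d (T : measurableType d) (R : realType)
    (mu : {measure set T -> \bar R}) (f h : T -> R) :
  mu.-integrable setT (EFin \o f) -> mu.-integrable setT (EFin \o h) ->
  mu.-integrable setT (EFin \o (fun x => f x + h x)).
Proof.
move=> fi hi; have := integrableD measurableT fi hi.
by apply: eq_integrable => // x _; rewrite /= EFinD.
Qed.

Section log_sobolev_bounded.
Context {R : realType} {n : nat} (p q : R).
Hypotheses (p2 : 2 <= p) (pq : p^-1 + q^-1 = 1).
Local Notation Phi := (@power_potential R n p).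
Local Notation mu := (gibbs_measure Phi).
Hypothesis Z0 : partition_function Phi != 0.
Variables (g : 'rV[R]_n -> R) (M L : R).
Hypotheses (C1g : C1 g) (gM : forall x, `|g x| <= M).
Local Notation G := (fun x => enorm (gradient g x)).
Hypothesis GL : forall x, G x <= L.
Hypothesis Gunif : forall e, 0 < e -> exists2 d, 0 < d & forall x y,
  enorm (x - y) < d -> G y <= G x + e.

Let mg : measurable_fun setT g.
Proof.
apply: continuous_measurable_rV => x; apply: differentiable_continuous.
by case: C1g => + _; apply.
Qed.

Let mG : measurable_fun setT G.
Proof.
apply: continuous_measurable_rV => x; apply: continuous_comp.
  by case: C1g => _; apply.
exact: continuous_enorm.
Qed.

Let mexp (f : 'rV[R]_n -> R) : measurable_fun setT f -> measurable_fun setT (expR \o f).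
Proof. exact: measurableT_comp. Qed.

Let mpow (f : 'rV[R]_n -> R) r : measurable_fun setT f ->
  measurable_fun setT (fun x => f x `^ r).
Proof. by move=> mf; exact: (measurableT_comp (measurable_powR r) mf). Qed.

Let iexp (f : 'rV[R]_n -> R) B : measurable_fun setT f -> (forall x, f x <= B) ->
  mu.-integrable setT (EFin \o (expR \o f)).
Proof.
move=> mf fB; apply: (@bounded_gibbs_integrable _ _ _ Z0 _ (expR B)); first exact: mexp.
by move=> x /=; rewrite ger0_norm ?expR_ge0// ler_expR.
Qed.

Let imul (f h : 'rV[R]_n -> R) B B' : measurable_fun setT f -> measurable_fun setT h ->
  (forall x, `|f x| <= B) -> (forall x, `|h x| <= B') ->
  mu.-integrable setT (EFin \o (fun x => f x * h x)).
Proof.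
move=> mf mh fB hB; apply: (@bounded_gibbs_integrable _ _ _ Z0 _ (B * B')).
  exact: measurable_funM.
by move=> x; rewrite normrM ler_pM.
Qed.

Let gle x : g x <= M. Proof. exact: le_trans (ler_norm _) (gM x). Qed.

Let eg x := expR (g x).
Let meg : measurable_fun setT eg. Proof. exact: mexp. Qed.
Let egM x : `|eg x| <= expR M.
Proof. by rewrite ger0_norm ?expR_ge0// ler_expR. Qed.

Let L0 : 0 <= L. Proof. exact: le_trans (enorm_ge0 _) (GL 0). Qed.

Let I := \int[mu]_x eg x.
Let J := \int[mu]_x (g x * eg x).

Let ieg : mu.-integrable setT (EFin \o eg).
Proof. by apply: bounded_gibbs_integrable => //; exact: egM. Qed.

Let exp_gt0 (f : 'rV[R]_n -> R) B : measurable_fun setT f -> (forall x, `|f x| <= B) ->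
  0 < \int[mu]_x expR (f x).
Proof.
move=> mf fB; apply: (@lt_le_trans _ _ (\int[mu]_x expR (- B))).
  by rewrite Rintegral_cst// /= [X in fine X](gibbs_measureT Z0) mulr1 expR_gt0.
apply: le_Rintegral => //.
- apply: (@bounded_gibbs_integrable _ _ _ Z0 _ (expR (- B))) => // x.
  by rewrite ger0_norm ?expR_ge0.
- by apply: (@iexp _ B) => // x; exact: le_trans (ler_norm _) _.
- by move=> x _; rewrite ler_expR; have := fB x; rewrite ler_norml => /andP[].
Qed.

Let I0 : 0 < I. Proof. exact: exp_gt0. Qed.

Section perturbation.
Variable e : R.
Hypotheses (e0 : 0 < e) (e1 : e < 1).

Let q12 := conjugate_exponent_bounds p2 pq.
Let q0 : 0 < q. Proof. by case/andP: q12 => h _; exact: lt_le_trans h. Qed.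

Let X x := (4 * (G x + e)) `^ q / q.
Let B := (4 * (L + e)) `^ q / q.

Let X0 x : 0 <= X x. Proof. by rewrite divr_ge0 ?powR_ge0 ?ltW. Qed.
Let XB x : X x <= B.
Proof.
rewrite ler_pM2r ?invr_gt0// ge0_ler_powR ?nnegrE ?mulr_ge0 ?addr_ge0 ?enorm_ge0
  ?(ltW e0) ?(ltW q0)//.
by rewrite ler_pM2l// lerD2r.
Qed.
Let mX : measurable_fun setT X.
Proof.
apply: measurable_funM => //; apply: mpow; apply: measurable_funM => //.
exact: measurable_funD.
Qed.

Lemma perturbed_integrable : mu.-integrable setT (EFin \o (fun x => X x * eg x)).
Proof. by apply: (imul mX meg) egM => x; rewrite ger0_norm. Qed.

(** With [t = 1 - s], the exponents [a = g / t] and [b = g + s X] satisfy the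
    hypothesis of [gibbs_prekopa_leindler]: for [x = z + s w], the growth of
    [g] from [z] to [x] is at most [s X z] plus the gain of convexity of the
    potential between [x] and [y = x - w]. As [s] tends to 0, the left-hand
    side expands to first order as the entropy of [exp g], the right-hand side
    as the integral of [X exp g]. *)
Lemma entropy_le_perturbed : J - I * ln I <= \int[mu]_x (X x * eg x).
Proof.
have p0 : 0 < p by exact: lt_le_trans p2.
have [s0 s00 gs] := growth_bound p2 q0 pq e0 (proj1 C1g) GL Gunif.
have iX := perturbed_integrable.
have B0 : 0 <= B by exact: le_trans (X0 0) (XB 0).
have iJ : mu.-integrable setT (EFin \o (fun x => g x * eg x)).
  exact: (imul mg meg gM egM).
pose s1 := Num.min s0 (Num.min 2^-1 (2 * (B + 1))^-1).
have s10 : 0 < s1 by rewrite !lt_min s00 !invr_gt0 ltr0n mulr_gt0// ltr_wpDl.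
apply: (@first_order_comparison _ (fun s => \int[mu]_x expR (g x / (1 - s)))
  _ _ _ (2 * B ^+ 2 * I) s1 I0 s10) => s s_gt0 ss1 slt1.
- have t0 : 0 < 1 - s by rewrite subr_gt0.
  rewrite /I /J -RintegralZl// -RintegralD//; last exact: integrable_scale.
  apply: le_Rintegral => //.
  + by apply: integrable_add => //; exact: integrable_scale.
  + apply: (@iexp _ (M / (1 - s))); first exact: measurable_funM.
    by move=> x; rewrite ler_pM2r ?invr_gt0//; exact: gle.
  + move=> x _; have -> : g x / (1 - s) = g x + s / (1 - s) * g x.
      by field; rewrite gt_eqF.
    rewrite expRD; have := expR_ge1Dx (s / (1 - s) * g x).
    rewrite -(ler_pM2l (expR_gt0 (g x))) /eg; lra.
- have t0 : 0 < 1 - s by rewrite subr_gt0.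
  move: ss1; rewrite !lt_min => /and3P[ss0 s2].
  rewrite -(ltr_pM2r (_ : 0 < 2 * (B + 1))) ?mulr_gt0 ?ltr_wpDl// mulVf; last first.
    by rewrite gt_eqF// mulr_gt0// ltr_wpDl.
  move=> sB.
  have i1 : mu.-integrable setT (EFin \o (expR \o (fun x => g x / (1 - s)))).
    apply: (@iexp _ (M / (1 - s))); first exact: measurable_funM.
    by move=> x; rewrite ler_pM2r ?invr_gt0//; exact: gle.
  have i2 : mu.-integrable setT (EFin \o (expR \o (fun x => g x + s * X x))).
    apply: (@iexp _ (M + s * B)).
      by apply: measurable_funD => //; exact: measurable_funM.
    by move=> x; apply: lerD; [exact: gle|rewrite ler_pM2l].
  apply: (@le_trans _ _ (\int[mu]_x expR (g x + s * X x))).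
    apply: (@gibbs_prekopa_leindler _ _ _ Z0 _ s (fun x => g x / (1 - s))) => //.
    + by rewrite subrK.
    + exact: measurable_funM.
    + by apply: measurable_funD => //; exact: measurable_funM.
    + apply: (@exp_gt0 _ (M / (1 - s))); first exact: measurable_funM.
      by move=> x; rewrite normrM [`|_^-1|]gtr0_norm ?invr_gt0// ler_pM2r ?invr_gt0.
    move=> x y; set z := (1 - s) *: x + s *: y.
    have -> : (1 - s) * (g x / (1 - s)) = g x by field; rewrite gt_eqF.
    have xE : x = z + s *: (x - y).
      rewrite /z scalerBr addrA addrAC addrK -scalerDl.
      by rewrite subrK scale1r.
    have ts : (1 - s) + s = 1 by rewrite subrK.
    have t2 : 2^-1 <= 1 - s by lra.
    have conv : Phi z + s * ((enorm (x - y) / 4) `^ p / p) <= (1 - s) * Phi x + s * Phi y.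
      exact: (power_potential_uniformly_convex x y p2 t2 (ltW s_gt0) ts).
    change (g x - ((1 - s) * Phi x + s * Phi y) <= g z + s * X z - Phi z).
    have gx : g x <= g z + s * ((enorm (x - y) / 4) `^ p / p + X z).
      by have := gs s z (x - y) s_gt0 ss0; rewrite -xE.
    apply: le_trans (lerB gx conv) _; rewrite le_eqVlt; apply/orP; left; apply/eqP.
    by ring.
  have i3 : mu.-integrable setT (EFin \o (fun x => s ^+ 2 * (2 * B ^+ 2 * eg x))).
    by do 2 apply: integrable_scale.
  rewrite /I -!RintegralZl//; last exact: integrable_scale.
  rewrite -RintegralD//; last exact: integrable_scale.
  rewrite -RintegralD//; last by apply: integrable_add => //; exact: integrable_scale.
  apply: le_Rintegral => //.
    by apply: integrable_add => //; apply: integrable_add => //; exact: integrable_scale.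
  move=> x _; rewrite expRD -/(eg x).
  have sX0 : 0 <= s * X x by rewrite mulr_ge0// ltW.
  have sX : s * X x <= 2^-1.
    have := ler_wpM2l (ltW s_gt0) (XB x); lra.
  have := expR_quadratic sX0 sX.
  have X2 : X x ^+ 2 <= B ^+ 2 by rewrite ler_sqr ?nnegrE.
  rewrite -(ler_pM2l (expR_gt0 (g x))) -/(eg x) => H; apply: le_trans H _.
  have : s ^+ 2 * eg x * X x ^+ 2 <= s ^+ 2 * eg x * B ^+ 2.
    by rewrite ler_wpM2l// mulr_ge0 ?sqr_ge0 ?expR_ge0.
  rewrite [(s * X x) ^+ 2]exprMn; lra.
Qed.

(** The constant 64 bounds [8 `^ q], as [q <= 2]. *)
Lemma perturbed_le x : X x <= 64 * (G x `^ q + e).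
Proof.
have [q1 q2] := andP q12.
have powle : (4 * (G x + e)) `^ q <= 64 * (G x `^ q + e).
  rewrite powRM ?addr_ge0 ?enorm_ge0 ?(ltW e0)//.
  apply: (@le_trans _ _ (4 `^ q * (2 `^ q * (G x `^ q + e `^ q)))).
    by rewrite ler_wpM2l ?powR_ge0// powR_addl_le ?enorm_ge0 ?(ltW e0) ?(ltW q0).
  rewrite mulrA -powRM//; apply: ler_pM; rewrite ?addr_ge0 ?powR_ge0//.
    have -> : 64 = 8 `^ 2%:R :> R by rewrite powR_mulrn//; ring.
    by rewrite (_ : 4 * 2 = 8 :> R) ?ler_powR ?ler1n//; ring.
  by rewrite lerD2l ge1r_powR// e0 ltW.
apply: le_trans powle; rewrite ler_pdivrMr// ler_peMr ?powR_ge0//.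
Qed.

End perturbation.

(** The limit of the perturbed inequality when [e] tends to 0. *)
Lemma log_sobolev_bounded :
  J - I * ln I <= 64 * \int[mu]_x (G x `^ q * eg x).
Proof.
have [q1 q2] := andP (conjugate_exponent_bounds p2 pq).
have q0 : 0 < q by exact: lt_le_trans q1.
have iG : mu.-integrable setT (EFin \o (fun x => G x `^ q * eg x)).
  apply: (imul (mpow q mG) meg) egM => x; rewrite ger0_norm ?powR_ge0//.
  apply: (ge0_ler_powR (ltW q0)) (GL x); rewrite nnegrE ?L0 ?enorm_ge0//.
rewrite -subr_le0; apply: (@ler_small_multiple _ _ (64 * I) 1) => // e e0 e1.
rewrite lerBlDr; apply: le_trans (entropy_le_perturbed e0) _.
rewrite mulrA -!RintegralZl// -RintegralD//; [|exact: integrable_scale..].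
apply: le_Rintegral => //.
- exact: perturbed_integrable.
- by apply: integrable_add; exact: integrable_scale.
move=> x _; have := perturbed_le e0 e1 x.
rewrite -(ler_pM2r (expR_gt0 (g x))) -/(eg x); lra.
Qed.

End log_sobolev_bounded.

(** * Truncation *)

Section truncation.
Context {R : realType}.

(** The increment of the function differs from its linear part by at most
    [h^2]. *)
Lemma is_derive_sqr_max0 (y : R) :
  is_derive y 1 (fun y => Num.max 0 y ^+ 2) (2 * Num.max 0 y).
Proof.
have sandwich (h : R) :
    `|Num.max 0 (h + y) ^+ 2 - Num.max 0 y ^+ 2 - h * (2 * Num.max 0 y)| <= h ^+ 2.
  rewrite ler_norml; case: (leP 0 (h + y)) => h1; case: (leP 0 y) => h2;
  by apply/andP; split; nra.
have lim : h^-1 *: (Num.max 0 (h *: (1 : R) + y) ^+ 2 - Num.max 0 y ^+ 2) @[h --> 0^']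
    --> 2 * Num.max 0 y.
  apply/cvgrPdist_le => e e0; near=> h.
  have h0 : h != 0 by near: h; exact: nbhs_dnbhs_neq.
  rewrite [h *: _]mulr1.
  have -> : 2 * Num.max 0 y - h^-1 *: (Num.max 0 (h + y) ^+ 2 - Num.max 0 y ^+ 2) =
     - (h^-1 * (Num.max 0 (h + y) ^+ 2 - Num.max 0 y ^+ 2 - h * (2 * Num.max 0 y))).
    by rewrite /GRing.scale /=; field.
  rewrite normrN normrM normfV ler_pdivrMl ?normr_gt0//.
  apply: le_trans (sandwich h) _; rewrite -real_normK ?num_real// expr2 ler_pM2l ?normr_gt0//.
  by near: h; apply: dnbhs0_le.
split; first by apply/cvg_ex; eexists; exact: lim.
exact/cvg_lim.
Unshelve. all: by end_near. Qed.

Context {n : nat} (q : R) (g : 'rV[R]_n -> R) (N e : R).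
Hypotheses (q12 : 1 <= q <= 2) (C1g : C1 g) (N0 : 0 < N) (e0 : 0 < e).

(** The truncation uses the square of this function, which is continuously
    differentiable. The gradient of this square is at most [4 / N] times its
    square root [cutoff], which is what makes [gradient_ln_truncation_le] hold without any
    term blowing up where the cutoff vanishes. *)
Definition cutoff (x : 'rV[R]_n) : R := Num.max 0 (1 - enorm x ^+ 2 / N ^+ 2).

(** Equal to the constant [e] outside of the ball of radius [N], so that its
    logarithm is bounded, with a compactly supported gradient. *)
Definition truncation (x : 'rV[R]_n) : R := e + cutoff x ^+ 2 * expR (g x).

Local Notation F := truncation.

Lemma cutoff_ge0 x : 0 <= cutoff x.
Proof. by rewrite le_max lexx. Qed.

Lemma cutoff_le1 x : cutoff x <= 1.
Proof. by rewrite ge_max ler01 lerBlDr lerDl divr_ge0 ?sqr_ge0. Qed.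

Lemma cutoff_outside x : N <= enorm x -> cutoff x = 0.
Proof.
move=> Nx; apply/max_idPl; rewrite subr_le0 ler_pdivlMr ?exprn_gt0// mul1r.
by rewrite ler_sqr ?nnegrE ?enorm_ge0 ?(ltW N0).
Qed.

Lemma cutoff_enorm_le x : cutoff x * enorm x <= cutoff x * N.
Proof.
have [xN|/ltW/cutoff_outside->] := leP (enorm x) N; last by rewrite !mul0r.
by rewrite ler_wpM2l// cutoff_ge0.
Qed.

Lemma truncation_ge x : e <= F x.
Proof. by rewrite lerDl mulr_ge0 ?sqr_ge0 ?expR_ge0. Qed.

Lemma truncation_gt0 x : 0 < F x.
Proof. exact: lt_le_trans (truncation_ge x). Qed.

Lemma truncation_le x : F x <= e + expR (g x).
Proof.
by rewrite lerD2l ler_piMl ?expR_ge0// expr_le1// ?cutoff_ge0// cutoff_le1.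
Qed.

Let cut_gradient x : differentiable (fun x => cutoff x ^+ 2) x /\
  gradient (fun x => cutoff x ^+ 2) x = (- (4 * cutoff x / N ^+ 2)) *: x.
Proof.
have [d1 gr1] := differentiable_gradient_sqr_enorm x.
pose a (u : R) : R := 1 - u / N ^+ 2.
have da (u : R) : is_derive u 1 a (- (N ^+ 2)^-1).
  have -> : a = cst 1 - (N ^+ 2)^-1 \*: id.
    by apply/funext => y; rewrite /a !fctE mulrC.
  by apply: is_derive_eq; rewrite sub0r; congr (- _); exact: mulr1.
have dt : is_derive (enorm x ^+ 2) 1 ((fun y => Num.max 0 y ^+ 2) \o a)
    (2 * cutoff x * (- (N ^+ 2)^-1)).
  by apply: is_derive1_comp; exact: is_derive_sqr_max0.
have [? ->] := differentiable_gradient_comp dt d1.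
by split => //; rewrite gr1 scalerA; congr (_ *: _); ring.
Qed.

Lemma differentiable_gradient_ln_truncation x : differentiable (@ln R \o F) x /\
  gradient (@ln R \o F) x = (F x)^-1 *:
   ((cutoff x ^+ 2 * expR (g x)) *: gradient g x -
    (4 * cutoff x / N ^+ 2 * expR (g x)) *: x).
Proof.
have [dg _] := C1g.
have [dexp grexp] := differentiable_gradient_comp (is_derive_expR (g x)) (dg x).
have [dcut grcut] := cut_gradient x.
have [dprod grprod] := differentiable_gradient_mul dcut dexp.
have dl : is_derive (cutoff x ^+ 2 * expR (g x)) 1 (@ln R \o (fun y => e + y)) ((F x)^-1 * 1).
  apply: is_derive1_comp.
    by apply: is_derive1_ln; exact: truncation_gt0.
  have -> : (fun y : R => e + y) = cst e + id by [].
  by apply: is_derive_eq; rewrite add0r.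
have [? ->] := differentiable_gradient_comp dl dprod.
split => //; rewrite grprod grexp grcut mulr1 !scalerA; congr (_ *: (_ + _)).
by rewrite -[RHS]scaleNr /=; congr (_ *: _); ring.
Qed.

Lemma C1_ln_truncation : C1 (@ln R \o F).
Proof.
split=> [x|]; first by case: (differentiable_gradient_ln_truncation x).
rewrite (_ : gradient _ = fun x => (F x)^-1 *:
   ((cutoff x ^+ 2 * expR (g x)) *: gradient g x -
    (4 * cutoff x / N ^+ 2 * expR (g x)) *: x)); last first.
  by apply/funext => x; case: (differentiable_gradient_ln_truncation x).
have [dg cg] := C1g.
have cexp : continuous (fun x => expR (g x)).
  move=> x; apply: (@continuous_comp _ _ _ g expR); last exact: continuous_expR.
  exact: differentiable_continuous.
have cenorm2 : continuous (fun x : 'rV[R]_n => enorm x ^+ 2).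
  move=> x; apply: differentiable_continuous.
  by case: (differentiable_gradient_sqr_enorm x).
have ccut : continuous cutoff.
  move=> x; apply: (@continuous_max R _ (cst 0)
    (fun x => 1 - enorm x ^+ 2 / N ^+ 2)); first exact: cst_continuous.
  apply: continuousB.
    exact: cst_continuous.
  by apply: continuousM; [exact: cenorm2|exact: cst_continuous].
have csq : continuous (fun x => cutoff x ^+ 2).
  by move=> x; apply: differentiable_continuous; case: (cut_gradient x).
have ccut2 : continuous (fun x => cutoff x ^+ 2 * expR (g x)).
  move=> x; exact: (@continuousM _ _ (fun x => cutoff x ^+ 2) (fun x => expR (g x)) x
    (csq x) (cexp x)).
have cF : continuous F.
  move=> x; rewrite /truncation.
  apply: (@continuousD R R^o 'rV[R]_n (cst e) (fun x => cutoff x ^+ 2 * expR (g x))).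
    exact: cst_continuous.
  exact: ccut2.
have cFV : continuous (fun x => (F x)^-1).
  by move=> x; apply: continuousV; [rewrite gt_eqF// truncation_gt0|exact: cF].
have ccoef : continuous (fun x => 4 * cutoff x / N ^+ 2 * expR (g x)).
  have -> : (fun x => 4 * cutoff x / N ^+ 2 * expR (g x)) =
      cst (4 / N ^+ 2) \* cutoff \* (fun x => expR (g x)).
    by apply/funext => x /=; ring.
  move=> x; apply: continuousM; last exact: cexp.
  by apply: continuousM; [exact: cst_continuous|exact: ccut].
move=> x; apply: (@continuousZ R 'rV[R]_n 'rV[R]_n (fun x => (F x)^-1)
  (fun x => (cutoff x ^+ 2 * expR (g x)) *: gradient g x -
    (4 * cutoff x / N ^+ 2 * expR (g x)) *: x) x (cFV x)).
apply: (@continuousB R 'rV[R]_n 'rV[R]_n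
    (fun x => (cutoff x ^+ 2 * expR (g x)) *: gradient g x)
    (fun x => (4 * cutoff x / N ^+ 2 * expR (g x)) *: x)).
  exact: (@continuousZ R 'rV[R]_n 'rV[R]_n _ _ x (ccut2 x) (cg x)).
apply: (@continuousZ R 'rV[R]_n 'rV[R]_n _ _ x (ccoef x)); exact: cvg_id.
Qed.

Lemma gradient_ln_truncation_outside x : N <= enorm x -> gradient (@ln R \o F) x = 0.
Proof.
move=> Nx; have [_ ->] := differentiable_gradient_ln_truncation x.
by rewrite cutoff_outside// expr0n /= mulr0 !mul0r !scale0r subr0 scaler0.
Qed.

Lemma powR_le_sum (x : R) : 0 <= x -> x `^ q <= x + x ^+ 2.
Proof.
have [q1 q2] := andP q12; move=> x0; have [x1|/ltW x1] := leP x 1.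
  have [->|xn0] := eqVneq x 0.
    by rewrite powR0 ?add0r ?sqr_ge0// gt_eqF// (lt_le_trans _ q1).
  apply: (@le_trans _ _ x); last by rewrite lerDl sqr_ge0.
  by apply: ge1r_powR => //; rewrite x1 andbT lt_neqAle eq_sym xn0.
apply: (@le_trans _ _ (x ^+ 2)); last by rewrite lerDr.
by rewrite -powR_mulrn// ler_powR.
Qed.

(** Write [F] for the truncation, [s] for the cutoff and [f] for [exp g]. The
    gradient of [ln F] has norm at most [r |grad g| + (4 / N) y], where
    [r = s^2 f / F <= 1] and [y = s f / F]. Then [r^q F <= r F <= f], and
    [y^q F <= (y + y^2) F = s f + r f <= 2 f], because [1 <= q <= 2]. *)
Lemma gradient_ln_truncation_le x :
  enorm (gradient (@ln R \o F) x) `^ q * F x <=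
  4 * (enorm (gradient g x) `^ q * expR (g x) + 2 * (4 / N) `^ q * expR (g x)).
Proof.
have [q1 q2] := andP q12.
have q0 : 0 <= q by exact: le_trans q1.
have [_ ->] := differentiable_gradient_ln_truncation x.
have Fp := truncation_gt0 x; have Fge : cutoff x ^+ 2 * expR (g x) <= F x by rewrite lerDr ltW.
have sg0 := cutoff_ge0 x; have sg1 := cutoff_le1 x; have f0 := expR_gt0 (g x).
set s := cutoff x in Fge sg0 sg1 *; set f := expR (g x) in f0 Fge *.
have N40 : 0 <= 4 / N by rewrite divr_ge0 ?(ltW N0).
set a := enorm (gradient g x); have a0 : 0 <= a := enorm_ge0 _.
set r := s ^+ 2 * f / F x.
have r0 : 0 <= r by rewrite divr_ge0 ?mulr_ge0 ?sqr_ge0 ?(ltW f0) ?(ltW Fp).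
have r1 : r <= 1 by rewrite ler_pdivrMr// mul1r.
set y := s * f / F x; have y0 : 0 <= y by rewrite divr_ge0 ?mulr_ge0 ?(ltW f0) ?(ltW Fp).
apply: (@le_trans _ _ ((r * a + 4 / N * y) `^ q * F x)).
  rewrite ler_pM2r// ge0_ler_powR ?nnegrE ?enorm_ge0//.
    by rewrite addr_ge0// mulr_ge0.
  rewrite enormZ gtr0_norm ?invr_gt0//.
  apply: (@le_trans _ _ ((F x)^-1 * (s ^+ 2 * f * a + 4 / N ^+ 2 * f * (s * enorm x)))).
    rewrite ler_pM2l ?invr_gt0//; apply: le_trans (ler_enormD _ _) _.
    rewrite -scaleNr !enormZ normrN !ger0_norm ?mulr_ge0 ?invr_ge0 ?sqr_ge0 ?(ltW f0)//.
    by rewrite lerD2l le_eqVlt; apply/orP; left; apply/eqP; ring.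
  have := cutoff_enorm_le x; rewrite -/s => sN.
  apply: (@le_trans _ _ ((F x)^-1 * (s ^+ 2 * f * a + 4 / N ^+ 2 * f * (s * N)))).
    rewrite ler_pM2l ?invr_gt0// lerD2l ler_wpM2l//.
    by rewrite mulr_ge0 ?divr_ge0 ?(ltW f0) ?sqr_ge0.
  rewrite le_eqVlt; apply/orP; left; apply/eqP; rewrite /r /y; field.
  by rewrite !gt_eqF.
have step1 : (r * a) `^ q * F x <= a `^ q * f.
  have rq : r `^ q <= r.
    have [->|rn0] := eqVneq r 0; first by rewrite powR0// gt_eqF// (lt_le_trans _ q1).
    by apply: ge1r_powR => //; rewrite r1 andbT lt_neqAle eq_sym rn0.
  rewrite powRM// [_ * a `^ q]mulrC -mulrA ler_wpM2l ?powR_ge0//.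
  apply: (@le_trans _ _ (r * F x)); first by rewrite ler_pM2r.
  rewrite divfK ?gt_eqF// ler_piMl ?(ltW f0)//.
  by rewrite expr_le1.
have step2 : y `^ q * F x <= 2 * f.
  apply: (@le_trans _ _ ((y + y ^+ 2) * F x)).
    by rewrite ler_pM2r// powR_le_sum.
  have -> : (y + y ^+ 2) * F x = s * f + r * f.
    by rewrite /r /y; field; rewrite gt_eqF.
  have : s * f <= 1 * f by rewrite ler_pM2r.
  have : r * f <= 1 * f by rewrite ler_pM2r.
  lra.
apply: (@le_trans _ _ (2 `^ q * ((r * a) `^ q + (4 / N * y) `^ q) * F x)).
  by rewrite ler_pM2r// powR_addl_le// mulr_ge0.
rewrite -mulrA; apply: ler_pM; rewrite ?powR_ge0//.
- by apply: mulr_ge0; [rewrite addr_ge0 ?powR_ge0|exact: ltW].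
- have -> : 4 = 2 `^ 2%:R :> R by rewrite powR_mulrn//; ring.
  by rewrite ler_powR ?ler1n.
rewrite mulrDl lerD// (powRM q N40 y0).
have := ler_wpM2l (powR_ge0 (4 / N) q) step2; lra.
Qed.

End truncation.

(** * The inequality for truncated functions *)

Section truncated_log_sobolev.
Context {R : realType} {n : nat} (p q : R).
Hypotheses (p2 : 2 <= p) (pq : p^-1 + q^-1 = 1).
Local Notation Phi := (@power_potential R n p).
Local Notation mu := (gibbs_measure Phi).
Hypothesis Z0 : partition_function Phi != 0.

Lemma bounded_constant_outside (f : 'rV[R]_n -> R) (r c : R) : continuous f ->
  0 <= r -> (forall x, r <= enorm x -> f x = c) -> exists M, forall x, `|f x| <= M.
Proof.
move=> cf r0 fc.
have [|||a _ amax] := @compact_EVT_max 'rV[R]_n R (fun x => `|f x|) [set x | enorm x <= r].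
- by exists 0; rewrite /= -(scale0r 0) enormZ normr0 mul0r.
- exact: compact_enorm_le.
- by apply: continuous_subspaceT => x; apply: continuous_comp; [exact: cf|exact: norm_continuous].
exists (Num.max `|f a| `|c|) => x; rewrite le_max.
have [xr|/ltW/fc ->] := leP (enorm x) r; last by rewrite lexx orbT.
by rewrite amax// inE.
Qed.

Variable g : 'rV[R]_n -> R.
Hypothesis C1g : C1 g.
Let f x := expR (g x).
Let Gf x := enorm (gradient g x) `^ q * expR (g x).
Hypotheses (If : mu.-integrable setT (EFin \o f))
           (IG : mu.-integrable setT (EFin \o Gf)).

Let I := \int[mu]_x f x.

(** The inequality for [ln F], where [F] is the truncation of [exp g], with its
    right-hand side bounded in terms of [g]; 256 is 64 times the factor 4 of
    [gradient_ln_truncation_le]. *)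
Lemma truncated_log_sobolev (N e : R) : 0 < N -> 0 < e ->
  \int[mu]_x (ln (truncation g N e x) * truncation g N e x) -
    (\int[mu]_x truncation g N e x) * ln (\int[mu]_x truncation g N e x)
  <= 256 * (\int[mu]_x Gf x + 2 * (4 / N) `^ q * I).
Proof.
move=> N0 e0; set F := truncation g N e.
have q12 := conjugate_exponent_bounds p2 pq.
pose h := @ln R \o F.
have hF x : expR (h x) = F x by rewrite lnK// posrE truncation_gt0.
have C1h : C1 h by exact: C1_ln_truncation.
have ch : continuous h.
  by move=> x; apply: differentiable_continuous; case: C1h => + _; apply.
have cG : continuous (fun x => enorm (gradient h x)).
  move=> x; apply: continuous_comp; last exact: continuous_enorm.
  by case: C1h => _; apply.
have G0 x : N <= enorm x -> enorm (gradient h x) = 0.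
  move=> Nx; rewrite gradient_ln_truncation_outside//.
  by rewrite -(scale0r 0) enormZ normr0 mul0r.
have [M hM] : exists M, forall x, `|h x| <= M.
  apply: (@bounded_constant_outside _ N (ln e) ch (ltW N0)) => x Nx.
  by rewrite /h /F /= /truncation cutoff_outside// expr0n /= mul0r addr0.
have [L GL] := bounded_constant_outside cG (ltW N0) G0.
have GL' x : enorm (gradient h x) <= L by exact: le_trans (ler_norm _) (GL x).
have Gunif e' : 0 < e' -> exists2 d, 0 < d & forall x y, enorm (x - y) < d ->
    enorm (gradient h y) <= enorm (gradient h x) + e'.
  move=> e'0; have [d d0 Hd] := unif_continuous_compact_support cG G0 e'0.
  exists d => // x y /Hd; rewrite distrC => /ltW/(le_trans (ler_norm _)).
  by rewrite lerBlDl.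
have := log_sobolev_bounded p2 pq Z0 C1h hM GL' Gunif.
have EF : (fun x => expR (h x)) = F by apply/funext => x; exact: hF.
rewrite EF.
under [X in X - _ <= _ -> _]eq_Rintegral do rewrite hF.
move=> H; apply: le_trans H _.
have -> : 256 = 64 * 4 :> R by ring.
rewrite -(mulrA 64 4) ler_pM2l// /I -RintegralZl//.
rewrite -RintegralD//; last exact: integrable_scale.
rewrite -RintegralZl//; last by apply: integrable_add => //; exact: integrable_scale.
apply: le_Rintegral => //.
- have mF : measurable_fun setT F.
    rewrite -EF; apply: measurableT_comp => //; exact: continuous_measurable_rV.
  apply: (@bounded_gibbs_integrable _ _ _ Z0 _ (L `^ q * expR M)).
    apply: measurable_funM; last by rewrite EF.
    apply: (measurableT_comp (measurable_powR q)); exact: continuous_measurable_rV.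
  move=> x; have q0 : 0 <= q by case/andP: q12 => + _; apply: le_trans.
  rewrite ger0_norm ?mulr_ge0 ?powR_ge0 ?expR_ge0//.
  apply: ler_pM; rewrite ?powR_ge0 ?expR_ge0//.
    by apply: ge0_ler_powR; rewrite ?nnegrE ?enorm_ge0// (le_trans (enorm_ge0 _) (GL' x)).
  by rewrite ler_expR (le_trans (ler_norm _)).
- by apply: integrable_scale; apply: integrable_add => //; exact: integrable_scale.
- by move=> x _; rewrite hF; exact: gradient_ln_truncation_le.
Qed.

End truncated_log_sobolev.

(** * Passage to the limit *)

Section entropy_limit.
Context {R : realType}.

(** The domination for the entropies of the truncations [F] of [f]. *)
Lemma norm_mulr_ln_le (f F : R) : 0 < f -> 0 < F -> F <= 1 + f ->
  `|ln F * F| <= 3 + 2 * f + 2 * `|f * ln f|.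
Proof.
move=> f0 F0 Ff.
have a0 : 0 <= `|f * ln f| by exact: normr_ge0.
have [F1|F1] := leP F 1.
  have := ln_tangent F0 (ltr01 : 0 < 1 :> R); rewrite ln1 => h.
  rewrite ler0_norm; last by rewrite mulr_le0_ge0 ?(ltW F0)// -ln1 ler_ln ?posrE.
  have : - ln F * F <= (1 / F - 1) * F by rewrite ler_pM2r//; lra.
  rewrite mulrBl divfK ?gt_eqF//; lra.
have lF0 : 0 <= ln F by rewrite -ln1 ler_ln ?posrE// ltW.
rewrite ger0_norm ?mulr_ge0 ?(ltW F0)//.
have lF : ln F <= ln (1 + f) by rewrite ler_ln ?posrE// addr_gt0.
apply: (@le_trans _ _ (ln (1 + f) * (1 + f))).
  by rewrite ler_pM ?(ltW F0).
have [f1|f1] := leP f 1.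
  have h : ln (1 + f) <= f by apply: le_ln1Dx; lra.
  have : ln (1 + f) * (1 + f) <= f * (1 + f) by rewrite ler_pM2r// addr_gt0.
  nra.
have h : ln (1 + f) <= ln f + f^-1.
  have := ln_tangent f0 (addr_gt0 ltr01 f0).
  by rewrite mulrDl mul1r divff ?gt_eqF// addrK.
have if1 : f^-1 <= 1 by rewrite invf_le1 ?(ltW f1).
have lf0 : 0 <= ln f by rewrite -ln1 ler_ln ?posrE// ltW.
have : ln (1 + f) * (1 + f) <= (ln f + 1) * (2 * f).
  by apply: ler_pM; [exact: le_trans lF|lra|lra|lra].
have : f * ln f <= `|f * ln f| by exact: ler_norm.
nra.
Qed.

Lemma cvg_truncation n (g : 'rV[R]_n -> R) x :
  truncation g k.+1%:R k.+1%:R^-1 x @[k --> \oo] --> expR (g x).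
Proof.
have harm : (k.+1%:R^-1 : R) @[k --> \oo] --> (0 : R) by exact: cvg_harmonic.
have cutc : cutoff k.+1%:R x @[k --> \oo] --> (1 : R).
  apply: (@squeeze_cvgr _ _ _ _
    (fun k : nat => 1 - enorm x ^+ 2 * (k.+1%:R^-1 * k.+1%:R^-1)) (fun=> 1)).
  - near=> k; rewrite cutoff_le1 andbT /cutoff -invfM -expr2.
    by rewrite le_max lexx orbT.
  - rewrite -[X in _ --> X](_ : 1 - enorm x ^+ 2 * (0 * 0) = 1 :> R); last first.
      by rewrite !mulr0 subr0.
    apply: cvgB; first exact: cvg_cst.
    by apply: cvgM; [exact: cvg_cst|apply: cvgM].
  - exact: cvg_cst.
rewrite -[X in _ --> X]add0r -[X in _ --> _ + X]mul1r.
apply: cvgD => //; apply: cvgM; last exact: cvg_cst.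
by rewrite -[X in _ --> X](mulr1 1) ; apply: cvgM.
Unshelve. all: by end_near. Qed.

End entropy_limit.

Section dominated.
Context d (T : measurableType d) (R : realType) (mu : {measure set T -> \bar R}).

Lemma Rintegral_dominated_cvg (f_ : nat -> T -> R) (f h : T -> R) :
  (forall k, measurable_fun setT (f_ k)) -> measurable_fun setT f ->
  (forall x, f_ ^~ x @ \oo --> f x) ->
  mu.-integrable setT (EFin \o h) -> (forall k x, `|f_ k x| <= h x) ->
  \int[mu]_x f_ k x @[k --> \oo] --> \int[mu]_x f x.
Proof.
move=> mf_ mf f_f ih fh; rewrite /Rintegral.
have mE (u : T -> R) : measurable_fun setT u -> measurable_fun setT (EFin \o u).
  by move=> mu_; exact/measurable_EFinP.
have cE : {ae mu, forall x, setT x -> (fun k => (f_ k x)%:E) @ \oo --> (f x)%:E}.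
  by apply: aeW => x _; apply: cvg_EFin; [exact: nearW|exact: f_f].
have dE : {ae mu, forall x k, setT x -> (`|(f_ k x)%:E| <= (h x)%:E)%E}.
  by apply: aeW => x k _; rewrite /= lee_fin.
have [fi _ cv] := dominated_convergence measurableT (fun k => mE _ (mf_ k)) (mE _ mf) cE ih dE.
by apply: fine_cvg; rewrite fineK ?integrable_fin_num.
Qed.

End dominated.

Section log_sobolev.
Context {R : realType} {n : nat} (p q : R).
Hypotheses (p2 : 2 <= p) (pq : p^-1 + q^-1 = 1).
Local Notation Phi := (@power_potential R n p).
Local Notation mu := (gibbs_measure Phi).
Hypothesis Z0 : partition_function Phi != 0.
Variable g : 'rV[R]_n -> R.
Hypothesis C1g : C1 g.
Let f x := expR (g x).
Let Gf x := enorm (gradient g x) `^ q * expR (g x).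
Hypotheses (If : mu.-integrable setT (EFin \o f))
           (Ifln : mu.-integrable setT (EFin \o (fun x => f x * ln (f x))))
           (IG : mu.-integrable setT (EFin \o Gf)).

(** The inequality for the truncations with [N = k + 1] and [e = 1 / (k + 1)],
    as [k] tends to infinity. All limits are dominated: the truncations are at
    most [1 + f], and their gradient terms are bounded by that of [g] up to a
    multiple of [(4 / N) `^ q]. *)
Lemma log_sobolev : 0 < \int[mu]_x f x ->
  \int[mu]_x (f x * ln (f x)) - (\int[mu]_x f x) * ln (\int[mu]_x f x)
  <= 256 * \int[mu]_x Gf x.
Proof.
set I := \int[mu]_x f x => I0.
have [q1 q2] := andP (conjugate_exponent_bounds p2 pq).
have f0 x : 0 < f x by exact: expR_gt0.
have e0 k : 0 < k.+1%:R^-1 :> R by rewrite invr_gt0.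
pose F k := truncation g k.+1%:R k.+1%:R^-1.
have F0 k x : 0 < F k x by apply: truncation_gt0; rewrite invr_gt0.
have Ff k x : F k x <= 1 + f x.
  by apply: le_trans (truncation_le _ _ _ _) _; rewrite lerD2r invf_le1// ler1n.
have FE k : F k = expR \o (@ln R \o F k).
  by apply/funext => x /=; rewrite lnK// posrE.
have mlnF k : measurable_fun setT (@ln R \o F k).
  apply: continuous_measurable_rV => x; apply: differentiable_continuous.
  by have [+ _] : C1 (@ln R \o F k) by [exact: C1_ln_truncation]; apply.
have mF k : measurable_fun setT (F k) by rewrite FE; exact: measurableT_comp.
have mf : measurable_fun setT f by apply/measurable_EFinP; exact: measurable_int If.
have cvgF x : F k x @[k --> \oo] --> f x by exact: cvg_truncation.
have one : mu.-integrable setT (EFin \o (fun=> 1 : R)).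
  by apply: (@bounded_gibbs_integrable _ _ _ Z0 _ 1) => // x; rewrite normr1.
have cvgI : \int[mu]_x F k x @[k --> \oo] --> I.
  apply: (@Rintegral_dominated_cvg _ _ _ _ _ _ (fun x => 1 + f x)) => //.
    exact: integrable_add.
  by move=> k x; rewrite gtr0_norm.
have cvgJ : \int[mu]_x (ln (F k x) * F k x) @[k --> \oo] --> \int[mu]_x (f x * ln (f x)).
  apply: (@Rintegral_dominated_cvg _ _ _ _ _ _
    (fun x => 3 * 1 + 2 * f x + 2 * `|f x * ln (f x)|)).
  - by move=> k; apply: measurable_funM => //; exact: mlnF.
  - by apply/measurable_EFinP; exact: measurable_int Ifln.
  - move=> x; rewrite mulrC; apply: cvgM => //.
    by apply: continuous_cvg => //; exact: continuous_ln.
  - apply: integrable_add; last first.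
      by apply: integrable_scale; exact: (integrable_norm Ifln).
    by apply: integrable_add; exact: integrable_scale.
  - by move=> k x; rewrite mulr1; exact: norm_mulr_ln_le.
have cvgL : \int[mu]_x (ln (F k x) * F k x) -
    (\int[mu]_x F k x) * ln (\int[mu]_x F k x) @[k --> \oo] -->
    \int[mu]_x (f x * ln (f x)) - I * ln I.
  apply: cvgB => //; apply: cvgM => //.
  by apply: continuous_cvg => //; exact: continuous_ln.
pose v k : R := 256 * (\int[mu]_x Gf x + 2 * (4 / k.+1%:R) * I).
have cvgv : v k @[k --> \oo] --> 256 * \int[mu]_x Gf x.
  have : v k @[k --> \oo] --> 256 * (\int[mu]_x Gf x + 2 * (4 * 0) * I).
    apply: cvgM; first exact: cvg_cst.
    apply: cvgD; first exact: cvg_cst.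
    apply: cvgM; last exact: cvg_cst.
    apply: cvgM; first exact: cvg_cst.
    by apply: cvgM; [exact: cvg_cst|exact: cvg_harmonic].
  by rewrite !mulr0 mul0r addr0.
(* From k = 4 on, 4 / (k + 1) <= 1, so its power q >= 1 is at most itself. *)
apply: (ler_cvg_to cvgL cvgv); exists 4%N => // k /= k4.
apply: le_trans (truncated_log_sobolev p2 pq Z0 C1g If IG _ _) _; rewrite ?invr_gt0//.
rewrite ler_pM2l// lerD2l ler_pM2r// ler_pM2l//.
apply: ge1r_powR => //; rewrite divr_gt0//= ler_pdivrMr// mul1r ler_nat.
exact: leq_trans k4 _.
Qed.

End log_sobolev.

Theorem corollary2p5 (R : realType) (n : nat) (p q : R) :
  2 <= p -> 1 / p + 1 / q = 1 ->
  let mu := gibbs_measure (@power_potential R n p) in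
  exists c : R, 0 < c /\
    forall g : 'rV[R]_n -> R,
      C1 g ->
      mu.-integrable setT (EFin \o (fun x => expR (g x))) ->
      mu.-integrable setT
        (EFin \o entropy_integrand mu (fun x => expR (g x))) ->
      mu.-integrable setT
        (EFin \o (fun x => enorm (gradient g x) `^ q * expR (g x))) ->
      entropy mu (fun x => expR (g x)) <=
        c * \int[mu]_x (enorm (gradient g x) `^ q * expR (g x)).
Proof.
move=> p2; rewrite !div1r => pq mu; exists 256; split=> // g C1g If Ient IG.
have G0 : 0 <= \int[mu]_x (enorm (gradient g x) `^ q * expR (g x)).
  by apply: Rintegral_ge0 => x _; rewrite mulr_ge0 ?powR_ge0 ?expR_ge0.
have triv : entropy mu (fun x => expR (g x)) = 0 ->
    entropy mu (fun x => expR (g x)) <=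
    256 * \int[mu]_x (enorm (gradient g x) `^ q * expR (g x)).
  by move=> ->; apply: mulr_ge0.
have [Z0|Z0] := eqVneq (partition_function (@power_potential R n p)) 0.
  (* Division by 0 yields 0, so mu is the zero measure. *)
  apply: triv; rewrite /entropy /Rintegral null_set_integral//.
    exact: measurable_int Ient.
  rewrite /mu /= /gibbs_measure Z0.
  by under eq_integral do rewrite invr0 mulr0; rewrite integral0.
set I := \int[mu]_y expR (g y).
have I0 : 0 <= I by apply: Rintegral_ge0 => x _; exact: expR_ge0.
have [Ieq0|In0] := eqVneq I 0.
  (* Here the argument of the logarithm is a division by 0, and ln 0 = 0. *)
  apply: triv; rewrite /entropy; under eq_Rintegral.
    by move=> x _; rewrite /entropy_integrand -/I Ieq0 invr0 mulr0 ln0// mulr0; over.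
  by rewrite Rintegral_cst// mul0r.
have Ip : 0 < I by rewrite lt_neqAle eq_sym In0.
have entE x : entropy_integrand mu (fun x => expR (g x)) x =
    expR (g x) * ln (expR (g x)) - ln I * expR (g x).
  by rewrite /entropy_integrand ln_div ?posrE ?expR_gt0// mulrBr [X in _ - X]mulrC.
have Ifln : mu.-integrable setT (EFin \o (fun x => expR (g x) * ln (expR (g x)))).
  have := integrable_add Ient (integrable_scale (ln I) If).
  by apply: eq_integrable => // x _ /=; rewrite entE subrK.
apply: le_trans (log_sobolev p2 pq Z0 C1g If Ifln IG Ip).
rewrite /entropy; under eq_Rintegral do rewrite entE.
by rewrite RintegralB// ?RintegralZl// 1?mulrC//; exact: integrable_scale.
Qed.
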